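(* Let $G=(V,\mathcal E,w)$ be an undirected, connected, weighted graph on $n$ nodes with Laplacian $L$, diagonal weighted-degree matrix $\Delta$, and largest Laplacian eigenvalue $\lambda_n$. Let $\tau\ge0$ with $\tau\lambda_n<\pi/2$. Consider the consensus network with receiver noise $$\dot x_i=\sum_{j\ne i}a_{ij}\big((x_j(t-\tau)+\xi_i(t))-x_i(t-\tau)\big),\qquad i\in V,$$ that is, $$\dot x(t)=-L\,x(t-\tau)+\Delta\,\xi(t),\qquad y=M_nx,$$ where $\xi_1,\dots,\xi_n$ are mutually independent zero-mean Gaussian white noises with intensities $\sigma_1^2,\dots,\sigma_n^2$. Then for every agent $i\in V$, $$\eta_i=\frac12\Big[\Delta^2L^{\dagger}\cos(\tau L)\big(M_n-\sin(\tau L)\big)^{\dagger}\Big]_{ii}.$$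
   Context: Notation: - $a_{ij}$ are the weighted adjacency entries. - $M_n=I_n-\frac1n\mathbf1\mathbf1^T$. - $X^\dagger$ is the Moore–Penrose pseudo-inverse. - $\cos(X)$ and $\sin(X)$ are the matrix power-series functions. The performance is $$\rho_{ss}=\lim_{t\to\infty}\mathbb E[y^Ty]=\frac1{2\pi}\int\mathrm{Tr}[G(j\omega)^HG(j\omega)]d\omega,\qquad G(s)=M_n(sI+e^{-\tau s}L)^{-1}\Delta\,\mathrm{diag}(\sigma_1,\dots,\sigma_n).$$ The centrality index of agent $i$ is $\eta_i=\partial\rho_{ss}/\partial\sigma_i^2$. *)

(* Defs.v *)
From HB Require Import structures.
From mathcomp Require Import all_boot all_order all_algebra.
From mathcomp Require Import all_classical all_reals all_analysis.
From mathcomp Require complex.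
Import complex.ComplexField.

Set Implicit Arguments.
Unset Strict Implicit.
Unset Printing Implicit Defensive.

Import Order.TTheory GRing.Theory Num.Theory.
Local Open Scope ring_scope.
Local Open Scope classical_set_scope.

Section Defs.
Variable R : realType.
Local Notation C := (complex.complex R).

(** Undirected, connected, weighted graph on the node set 'I_n, given by its
    weighted adjacency matrix a (a i j = weight of edge {i,j}, 0 if no edge). *)
Definition weighted_graph n (a : 'M[R]_n) : Prop :=
  (forall i j, a i j = a j i) /\ (forall i j, 0 <= a i j) /\ (forall i, a i i = 0).

Definition graph_connected n (a : 'M[R]_n) : Prop :=
  forall i j : 'I_n, connect (fun k l : 'I_n => 0 < a k l) i j.

Definition degmx n (a : 'M[R]_n) : 'M[R]_n := diag_mx (\row_i \sum_j a i j).
Definition laplacian n (a : 'M[R]_n) : 'M[R]_n := degmx a - a.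

Definition lambda_max n (L : 'M[R]_n) : R := sup [set x : R | eigenvalue L x].

Definition Mn n : 'M[R]_n := 1%:M - (n%:R)^-1 *: const_mx 1.

Definition matcos n (X : 'M[R]_n) : 'M[R]_n :=
  \matrix_(i, j) limn (fun N => \sum_(0 <= k < N)
      ((-1) ^+ k / ((2 * k)`!)%:R * (X ^+ (2 * k)) i j)).
Definition matsin n (X : 'M[R]_n) : 'M[R]_n :=
  \matrix_(i, j) limn (fun N => \sum_(0 <= k < N)
      ((-1) ^+ k / ((2 * k).+1`!)%:R * (X ^+ (2 * k).+1) i j)).

Definition penrose m n (A : 'M[R]_(m, n)) (X : 'M[R]_(n, m)) : Prop :=
  [/\ A *m X *m A = A, X *m A *m X = X, (A *m X)^T = A *m X & (X *m A)^T = X *m A].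
Definition mp_pinv m n (A : 'M[R]_(m, n)) : 'M[R]_(n, m) := xget 0 [set X | penrose A X].

Definition toC (x : R) : C := complex.Complex x 0.
Definition mxC m n (A : 'M[R]_(m, n)) : 'M[C]_(m, n) := map_mx toC A.
Definition adjC m n (A : 'M[C]_(m, n)) : 'M[C]_(n, m) := (map_mx (@complex.conjc R) A)^T.

(** Transfer matrix G(j w) = M_n (j w I + e^{-j w tau} L)^{-1} Delta diag(sigma),
    with e^{-j w tau} = cos(w tau) - j sin(w tau). *)
Definition Gjw n (tau : R) (a : 'M[R]_n) (sigma : 'I_n -> R) (w : R) : 'M[C]_n :=
  @mxC n n (Mn n)
  *m invmx (complex.Complex 0 w *: 1%:M
            + complex.Complex (cos (w * tau)) (- sin (w * tau)) *: mxC (laplacian a))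
  *m mxC (degmx a) *m mxC (diag_mx (\row_i sigma i)).

Definition rho_ss n (tau : R) (a : 'M[R]_n) (sigma : 'I_n -> R) : R :=
  (2 * pi)^-1 * fine (\int[@lebesgue_measure R]_(w in [set: R])
     (complex.Re (\tr (adjC (Gjw tau a sigma w) *m Gjw tau a sigma w)))%:E)%E.

(** rho_ss as a function of the noise intensities q_i = sigma_i^2. *)
Definition rho_int n (tau : R) (a : 'M[R]_n) (q : 'I_n -> R) : R :=
  rho_ss tau a (fun i => Num.sqrt (q i)).

Definition upd n (q : 'I_n -> R) (i : 'I_n) (t : R) : 'I_n -> R :=
  fun k => if k == i then t else q k.

End Defs.

(* Main.v *)
Require Import Defs.
From HB Require Import structures.
From mathcomp Require Import all_boot all_order all_algebra.
From mathcomp Require Import all_classical all_reals all_analysis.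
From mathcomp Require Import measurable_realfun spectral complex.
From mathcomp Require Import ring lra.
Import Order.TTheory GRing.Theory Num.Theory.
Import numFieldNormedType.Exports.
Import complex.ComplexField.
Set Implicit Arguments.
Unset Strict Implicit.
Unset Printing Implicit Defensive.
Local Open Scope ring_scope.
Local Open Scope classical_set_scope.

(* Diagonalising L reduces the trace integral to the scalar integrals of
   f(u) = 1 / |p(iu)|^2, p(s) = s + l e^{-tau s}, one for each eigenvalue l > 0.
   Put rho(t) = int cos(tu) f(u) du. Since tau l < pi/2, p has no zero in the
   closed right half-plane, so for t > 0 the contour of e^{-ts} / p(s) can be
   pushed to Re s = +oo: the integral of e^{-itu} / p(iu) vanishes, which says
   rho'(t) = - l rho(tau - t). Hence rho(t) cos(lt) + rho(tau - t) sin(lt) is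
   constant on [0, tau] and rho(0) (1 - sin(l tau)) = rho(tau) cos(l tau). The
   same argument for 1/p(s) - 1/(1+s) gives l rho(tau) = int du/(1+u^2) = pi.
   So int f = rho(0) = pi cos(l tau) / (l (1 - sin(l tau))), and rho_ss is linear
   in the intensities. *)

(** Complex functions are carried as pairs of real functions of [(s, u)], and Cauchy's theorem on a
    rectangle becomes the mean value theorem for the line integral as a function of the abscissa.
    The obstacle is the slow decay of [e^{-ts} / p(s)], only O(1/|s|) on the imaginary axis: it is
    not absolutely integrable there, nor in general is the t-derivative of the integrand of [rho].
    So the delay equation is proved only for truncations to [[-X^3, X^3]], with an error of order
    1/X coming from the other three edges of a rectangle of width [X^2]. That error is uniform only
    for [t >= e > 0]: the first integral is compared between [e] and [tau - e], then X tends to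
    infinity, and last [e] tends to 0 by continuity of [rho]. Two degenerate spots are treated
    apart. At [w = 0] the matrix to be inverted is the singular [L], so the transfer matrix takes a
    default value there; one point does not affect the integral. The consensus mode [l = 0] lies
    outside the scalar computation: [M_n] removes it from the trace, and the convention [0^-1 = 0]
    removes it from the closed formula. *)

(** * Calculus for integrals over a segment *)

Section integrals.
Context {R : realType}.
Local Notation mu := (@lebesgue_measure R).

Lemma continuous_itv_integrable (f : R -> R) (a b : R) :
  continuous f -> mu.-integrable `[a, b] (EFin \o f).
Proof.
move=> cf; apply: continuous_compact_integrable; first exact: segment_compact.
exact: continuous_subspaceT.
Qed.

Lemma Rintegral_FTC2 (F f : R -> R) (a b : R) : a < b -> continuous f ->
  (forall x : R, is_derive x 1 F (f x)) ->
  \int[mu]_(x in `[a, b]) f x = F b - F a.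
Proof.
move=> ab cf dF.
have cF : continuous F.
  by move=> x; apply: differentiable_continuous; apply/derivable1_diffP/ex_derive.
rewrite /Rintegral (@continuous_FTC2 _ f F)//.
- exact: continuous_subspaceT.
- split; first by move=> x _; apply: ex_derive.
  + by apply: cvg_at_right_filter; exact: cF.
  + by apply: cvg_at_left_filter; exact: cF.
- by move=> x _; rewrite derive1E; apply: derive_val.
Qed.

Lemma normr_Rintegral_le (f : R -> R) (a b M : R) : a <= b -> continuous f ->
  (forall x, a <= x <= b -> `|f x| <= M) ->
  `|\int[mu]_(x in `[a, b]) f x| <= M * (b - a).
Proof.
move=> ab cf fM.
have cn : continuous (fun x => `|f x|).
  by move=> x; apply: continuous_comp; [exact: cf|exact: norm_continuous].
apply: (le_trans (le_normr_Rintegral _ _)) => //.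
  exact: continuous_itv_integrable.
have -> : M * (b - a) = \int[mu]_(x in `[a, b]) (cst M x).
  rewrite Rintegral_cst//= lebesgue_measure_itv/= lte_fin.
  by case: ltgtP ab => //= -> _; rewrite subrr mulr0.
apply: le_Rintegral => //.
- exact: continuous_itv_integrable.
- by apply: continuous_itv_integrable => x; exact: cvg_cst.
Qed.

(** A constant dominates because [u] ranges over a segment; [v] and [w] only delimit a neighbourhood
    of [x] on which the bound is uniform. *)
Lemma is_derive_under_Rintegral (f g : R -> R -> R) (a b x v w M : R) :
  v < x < w -> (forall y, continuous (f y)) ->
  (forall y u : R, is_derive y 1 (f^~ u) (g y u)) ->
  (forall y u, v < y < w -> a <= u <= b -> `|g y u| <= M) ->
  is_derive x 1 (fun y => \int[mu]_(u in `[a, b]) f y u)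
                (\int[mu]_(u in `[a, b]) g x u).
Proof.
move=> vxw cf dfg gM.
have gE : partial1of2 f = g.
  by apply/funext => y; apply/funext => u; rewrite partial1of2E; apply: derive_val.
have Ix : (`]v, w[ : set R) x by rewrite /= in_itv.
have int y : (`]v, w[ : set R) y -> mu.-integrable `[a, b] (EFin \o f y).
  by move=> _; exact: continuous_itv_integrable.
have der y u : (`]v, w[ : set R) y -> (`[a, b] : set R) u -> derivable (f ^~ u) y 1.
  by move=> _ _; apply: ex_derive.
have M0 (u : R) : 0 <= `|M| by [].
have iM : mu.-integrable `[a, b] (EFin \o (fun=> `|M|)).
  by apply: continuous_itv_integrable => y; exact: cvg_cst.
have G y u : (`]v, w[ : set R) y -> (`[a, b] : set R) u -> `|partial1of2 f y u| <= `|M|.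
  rewrite /= !in_itv/= gE => yvw uab.
  by rewrite (le_trans (gM _ _ yvw uab))// ler_norm.
have mab : measurable (`[a, b]%classic : set (measurableTypeR R)) by [].
apply: DeriveDef; first exact: (derivable_under_integral mab Ix int der M0 iM G).
by rewrite -derive1E (differentiation_under_integral mab Ix int der M0 iM G) gE.
Qed.

End integrals.

(** * Holomorphic functions in real coordinates and the rectangle estimate *)

Section holomorphy.
Context {R : realType}.
Local Notation mu := (@lebesgue_measure R).
Implicit Types P Q A B : R -> R -> R.

(* [P + iQ] is holomorphic in [s + iu] on the closed right half-plane, with
   derivative [A + iB]: the Cauchy-Riemann equations in real coordinates. *)
Definition hol P Q A B := forall s u : R, 0 <= s ->
  [/\ is_derive s 1 (P^~ u) (A s u), is_derive s 1 (Q^~ u) (B s u),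
      is_derive u 1 (P s) (- B s u), is_derive u 1 (Q s) (A s u) &
      {for u, continuous (A s)} /\ {for u, continuous (B s)}].

Lemma is_derive_continuous (f : R -> R) (x df : R) :
  is_derive x 1 f df -> {for x, continuous f}.
Proof. by move=> ?; apply/differentiable_continuous/derivable1_diffP/ex_derive. Qed.

Lemma hol_id : hol (fun s _ => s) (fun _ u => u) (fun _ _ => 1) (fun _ _ => 0).
Proof.
move=> s u _; rewrite oppr0; split; last by split; exact: cvg_cst.
- exact: is_derive_id.
- exact: is_derive_cst.
- exact: is_derive_cst.
- exact: is_derive_id.
Qed.

Lemma hol_cst c : hol (fun _ _ => c) (fun _ _ => 0) (fun _ _ => 0) (fun _ _ => 0).
Proof.
move=> s u _; rewrite oppr0; split; last by split; exact: cvg_cst.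
all: exact: is_derive_cst.
Qed.

(** [expP] and [expQ] are the real and imaginary parts of [e^{-t(s + iu)}]. *)
Definition expP (t s u : R) := expR (- (t * s)) * cos (t * u).
Definition expQ (t s u : R) := - (expR (- (t * s)) * sin (t * u)).

Lemma is_derive_lin (t x : R) : is_derive x 1 (fun y => t * y) t.
Proof.
by apply: is_derive_eq (is_deriveZ t (is_derive_id x 1)) _; rewrite [LHS]mulr1.
Qed.

Lemma is_derive_expN (t s : R) :
  is_derive s 1 (fun y => expR (- (t * y))) (- t * expR (- (t * s))).
Proof.
have H := is_deriveN (is_derive_lin t s).
by apply: is_derive_eq (is_derive1_comp (f := expR) _ H) _; rewrite mulrC.
Qed.

Lemma is_derive_cosl (t u : R) :
  is_derive u 1 (fun y => cos (t * y)) (- (t * sin (t * u))).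
Proof.
apply: is_derive_eq (is_derive1_comp (f := cos) _ (is_derive_lin t u)) _.
by rewrite mulNr mulrC.
Qed.

Lemma is_derive_sinl (t u : R) :
  is_derive u 1 (fun y => sin (t * y)) (t * cos (t * u)).
Proof.
apply: is_derive_eq (is_derive1_comp (f := sin) _ (is_derive_lin t u)) _.
by rewrite mulrC.
Qed.

Lemma hol_exp t : hol (expP t) (expQ t)
  (fun s u => - t * expP t s u) (fun s u => - t * expQ t s u).
Proof.
move=> s u _.
have d1 := is_derive_expN t s.
have d2 := is_derive_cosl t u.
have d3 := is_derive_sinl t u.
have e1 : is_derive s 1 (expP t ^~ u) (- t * expP t s u).
  apply: is_derive_eq (is_deriveM d1 (is_derive_cst (cos (t * u)) s 1)) _.
  by rewrite /GRing.scale/= /expP; ring.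
have e2 : is_derive s 1 (expQ t ^~ u) (- t * expQ t s u).
  apply: is_derive_eq (is_deriveN (is_deriveM d1 (is_derive_cst (sin (t * u)) s 1))) _.
  by rewrite /GRing.scale/= /expQ; ring.
have e3 : is_derive u 1 (expP t s) (t * expQ t s u).
  apply: is_derive_eq (is_deriveZ (expR (- (t * s))) d2) _.
  by rewrite /GRing.scale/= /expQ; ring.
have e4 : is_derive u 1 (expQ t s) (- t * expP t s u).
  apply: is_derive_eq (is_deriveN (is_deriveZ (expR (- (t * s))) d3)) _.
  by rewrite /GRing.scale/= /expP; ring.
split => //; first by rewrite mulNr opprK.
by split; apply: continuousM; try exact: cvg_cst;
  [exact: is_derive_continuous e3|exact: is_derive_continuous e4].
Qed.

Lemma holD P Q A B P' Q' A' B' : hol P Q A B -> hol P' Q' A' B' ->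
  hol (fun s u => P s u + P' s u) (fun s u => Q s u + Q' s u)
      (fun s u => A s u + A' s u) (fun s u => B s u + B' s u).
Proof.
move=> h h' s u s0; have [a1 a2 a3 a4 [a5 a6]] := h s u s0.
have [b1 b2 b3 b4 [b5 b6]] := h' s u s0.
split; [exact: is_deriveD|exact: is_deriveD| |exact: is_deriveD|].
  by rewrite opprD; exact: is_deriveD.
by split; apply: continuousD.
Qed.

Lemma holZ c P Q A B : hol P Q A B ->
  hol (fun s u => c * P s u) (fun s u => c * Q s u)
      (fun s u => c * A s u) (fun s u => c * B s u).
Proof.
move=> h s u s0; have [a1 a2 a3 a4 [a5 a6]] := h s u s0.
split; [exact: is_deriveZ|exact: is_deriveZ| |exact: is_deriveZ|].
  by rewrite -mulrN; exact: is_deriveZ.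
by split; apply: continuousM => //; exact: cvg_cst.
Qed.

Lemma holM P Q A B P' Q' A' B' : hol P Q A B -> hol P' Q' A' B' ->
  hol (fun s u => P s u * P' s u - Q s u * Q' s u)
      (fun s u => P s u * Q' s u + Q s u * P' s u)
      (fun s u => (P s u * A' s u - Q s u * B' s u) +
                  (A s u * P' s u - B s u * Q' s u))
      (fun s u => (P s u * B' s u + Q s u * A' s u) +
                  (A s u * Q' s u + B s u * P' s u)).
Proof.
move=> h h' s u s0; have [a1 a2 a3 a4 [a5 a6]] := h s u s0.
have [b1 b2 b3 b4 [b5 b6]] := h' s u s0.
have cP := is_derive_continuous a3; have cQ := is_derive_continuous a4.
have cP' := is_derive_continuous b3; have cQ' := is_derive_continuous b4.
split.
- by apply: is_derive_eq (is_deriveB (is_deriveM a1 b1) (is_deriveM a2 b2)) _;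
    rewrite /GRing.scale/=; ring.
- by apply: is_derive_eq (is_deriveD (is_deriveM a1 b2) (is_deriveM a2 b1)) _;
    rewrite /GRing.scale/=; ring.
- by apply: is_derive_eq (is_deriveB (is_deriveM a3 b3) (is_deriveM a4 b4)) _;
    rewrite /GRing.scale/=; ring.
- by apply: is_derive_eq (is_deriveD (is_deriveM a3 b4) (is_deriveM a4 b3)) _;
    rewrite /GRing.scale/=; ring.
- split; apply: continuousD; [apply: continuousB|apply: continuousB| apply: continuousD|
   apply: continuousD]; exact: continuousM.
Qed.

(** [invP] and [invQ] are the real and imaginary parts of [1 / (P + iQ)]. *)
Definition invP P Q (s u : R) := P s u / (P s u ^+ 2 + Q s u ^+ 2).
Definition invQ P Q (s u : R) := - Q s u / (P s u ^+ 2 + Q s u ^+ 2).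

(** The derivative is [- f' (1/f)^2]. Writing it through [1/f] instead of [f] lets bounds on [f']
    and [1/f] bound it directly. *)
Lemma holV P Q A B : hol P Q A B ->
  (forall s u : R, 0 <= s -> P s u ^+ 2 + Q s u ^+ 2 != 0) ->
  hol (invP P Q) (invQ P Q)
   (fun s u => - (A s u * (invP P Q s u ^+ 2 - invQ P Q s u ^+ 2)
                  - B s u * (2 * invP P Q s u * invQ P Q s u)))
   (fun s u => - (A s u * (2 * invP P Q s u * invQ P Q s u)
                  + B s u * (invP P Q s u ^+ 2 - invQ P Q s u ^+ 2))).
Proof.
move=> h n0 s u s0; have [a1 a2 a3 a4 [a5 a6]] := h s u s0.
have n := n0 s u s0.
have dN f g (x df dg : R) : is_derive x 1 f df -> is_derive x 1 g dg ->
    f x ^+ 2 + g x ^+ 2 != 0 ->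
    is_derive x 1 (fun y => (f y ^+ 2 + g y ^+ 2)^-1)
      (- (f x ^+ 2 + g x ^+ 2) ^- 2 * (2 * f x * df + 2 * g x * dg)).
  move=> d1 d2 nz.
  have := is_deriveD (is_deriveX 2 d1) (is_deriveX 2 d2).
  move=> /(@is_deriveV _ (fun y => f y ^+ 2 + g y ^+ 2) _ _ _ nz) H.
  apply: is_derive_eq H _; rewrite /GRing.scale/= expr1; ring.
have i1 := dN _ _ _ _ _ a1 a2 n.
have i2 := dN _ _ _ _ _ a3 a4 n.
have e3 : is_derive u 1 (invP P Q s) (- - (A s u * (2 * invP P Q s u * invQ P Q s u)
                  + B s u * (invP P Q s u ^+ 2 - invQ P Q s u ^+ 2))).
  by apply: is_derive_eq (is_deriveM a3 i2) _; rewrite /GRing.scale/= ?fctE /invP /invQ; field.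
have e4 : is_derive u 1 (invQ P Q s) (- (A s u * (invP P Q s u ^+ 2 - invQ P Q s u ^+ 2)
                  - B s u * (2 * invP P Q s u * invQ P Q s u))).
  by apply: is_derive_eq (is_deriveM (is_deriveN a4) i2) _;
    rewrite /GRing.scale/= ?fctE /invP /invQ; field.
split => //.
- by apply: is_derive_eq (is_deriveM a1 i1) _; rewrite /GRing.scale/= ?fctE /invP /invQ; field.
- by apply: is_derive_eq (is_deriveM (is_deriveN a2) i1) _;
    rewrite /GRing.scale/= ?fctE /invP /invQ; field.
- have cP := is_derive_continuous e3; have cQ := is_derive_continuous e4.
  have c2 : {for u, continuous (fun u => invP P Q s u ^+ 2 - invQ P Q s u ^+ 2)}.
    by apply: continuousB; apply: continuousM.
  have c3 : {for u, continuous (fun u => 2 * invP P Q s u * invQ P Q s u)}.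
    by apply: continuousM => //; apply: continuousM => //; exact: cvg_cst.
  by split; apply: continuousN; [apply: continuousB|apply: continuousD]; exact: continuousM.
Qed.

Definition bnd2 P Q := exists M : R, forall s u : R, 0 <= s -> `|P s u| <= M /\ `|Q s u| <= M.

Lemma bnd2D P Q P' Q' : bnd2 P Q -> bnd2 P' Q' ->
  bnd2 (fun s u => P s u + P' s u) (fun s u => Q s u + Q' s u).
Proof.
move=> [M h] [M' h']; exists (M + M') => s u s0.
have [a b] := h s u s0; have [c d] := h' s u s0.
by split; apply: le_trans (ler_normD _ _) _; exact: lerD.
Qed.

Lemma bnd2Z c P Q : bnd2 P Q -> bnd2 (fun s u => c * P s u) (fun s u => c * Q s u).
Proof.
move=> [M h]; exists (`|c| * M) => s u s0.
by have [a b] := h s u s0; rewrite !normrM !ler_wpM2l.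
Qed.

Lemma bnd2M P Q P' Q' : bnd2 P Q -> bnd2 P' Q' ->
  bnd2 (fun s u => P s u * P' s u - Q s u * Q' s u)
       (fun s u => P s u * Q' s u + Q s u * P' s u).
Proof.
move=> [M h] [M' h']; exists (M * M' + M * M') => s u s0.
have [a b] := h s u s0; have [c d] := h' s u s0.
by split; [apply: le_trans (ler_normB _ _) _|apply: le_trans (ler_normD _ _) _];
   rewrite !normrM lerD// ler_pM.
Qed.

(* The line integral of a holomorphic function along [Re = 0] is pushed to
   [Re = X^2]. Parametrising the abscissa by a square lets it be differentiated
   at its left end without one-sided derivatives. *)
Lemma contour_bound P Q A B (X T b1 b2 : R) : hol P Q A B -> bnd2 A B ->
  0 < X -> 0 < T ->
  (forall u, `|u| <= T -> `|P (X ^+ 2) u| <= b1) ->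
  (forall s, 0 <= s <= X ^+ 2 -> `|Q s T| <= b2 /\ `|Q s (- T)| <= b2) ->
  `|\int[mu]_(u in `[- T, T]) P 0 u| <= 2 * T * b1 + 4 * X ^+ 2 * b2.
Proof.
move=> h [M hM] X0 T0 hP hQ.
pose Phi y := \int[mu]_(u in `[- T, T]) P (y ^+ 2) u.
have cP s : 0 <= s -> continuous (P s).
  by move=> s0 u; have [_ _ /is_derive_continuous] := h s u s0.
have dPhi (x : R) : is_derive x 1 Phi (2 * x * (Q (x ^+ 2) T - Q (x ^+ 2) (- T))).
  pose g (y u : R) := 2 * y * A (y ^+ 2) u.
  (* By Cauchy-Riemann the abscissa-derivative [A] of [P] is also the [u]-derivative of [Q], so its
     integral collapses to the values of [Q] on the two horizontal edges. *)
  have -> : 2 * x * (Q (x ^+ 2) T - Q (x ^+ 2) (- T)) = \int[mu]_(u in `[- T, T]) g x u.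
    have cg : continuous (g x).
      move=> u; have [_ _ _ _ [cA _]] := h (x ^+ 2) u (sqr_ge0 _).
      by apply: (@continuousM _ _ (fun=> 2 * x) (A (x ^+ 2))) => //; exact: cvg_cst.
    have dg (u : R) : is_derive u 1 (fun u => 2 * x * Q (x ^+ 2) u) (g x u).
      have [_ _ _ dQ _] := h (x ^+ 2) u (sqr_ge0 _).
      exact: is_deriveZ.
    have TT : - T < T by rewrite gtrN.
    by rewrite (Rintegral_FTC2 TT cg dg) mulrBr.
  apply: (@is_derive_under_Rintegral _ _ _ _ _ x (x - 1) (x + 1)
     (2 * (`|x| + 1) * `|M|)).
  - by rewrite ltrDl ltr01 gtrBl ltr01.
  - by move=> y; apply: cP; exact: sqr_ge0.
  - move=> y u; have [dP _ _ _ _] := h (y ^+ 2) u (sqr_ge0 _).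
    have dy : is_derive y 1 (fun z : R => z ^+ 2) (2 * y).
      by apply: is_derive_eq (is_deriveX 2 (is_derive_id y 1)) _;
        rewrite /= /GRing.scale/= expr1 mulr1; ring.
    by apply: is_derive_eq (is_derive1_comp (f := P ^~ u) _ dy) _; rewrite mulrC.
  - move=> y u yx _; rewrite /g !normrM ger0_norm//.
    have [hA _] := hM (y ^+ 2) u (sqr_ge0 _).
    apply: ler_pM => //.
      rewrite ler_pM2l//; have -> : y = x + (y - x) by ring.
      apply: le_trans (ler_normD _ _) _; rewrite lerD2l ler_norml; lra.
    by apply: le_trans hA _; exact: ler_norm.
have [|c] := @MVT _ Phi _ 0 X X0 (fun x _ => dPhi x).
  by apply: continuous_subspaceT => x; exact: is_derive_continuous (dPhi x).
rewrite in_itv/= subr0 => /andP[c0 cX] E.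
(* The mean value theorem leaves [2 c (Q T - Q (- T)) X] with [0 < c < X], whence the factor
   [4 X^2]. *)
have Ec : `|Phi X - Phi 0| <= 4 * X ^+ 2 * b2.
  have [|q1 q2] := hQ (c ^+ 2).
    by rewrite sqr_ge0 ler_sqr ?nnegrE ltW.
  rewrite E !normrM ger0_norm// (gtr0_norm c0) (gtr0_norm X0).
  have q3 : `|Q (c ^+ 2) T - Q (c ^+ 2) (- T)| <= b2 + b2.
    by apply: le_trans (ler_normB _ _) _; exact: lerD.
  have q4 : 0 <= b2 by exact: le_trans q1.
  have : 2 * c * `|Q (c ^+ 2) T - Q (c ^+ 2) (- T)| <= 2 * X * (b2 + b2).
    by apply: ler_pM => //; [rewrite mulr_ge0 ?ltW | rewrite ler_pM2l// ltW].
  move=> /(ler_wpM2r (ltW X0)) H; apply: le_trans H _.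
  by rewrite le_eqVlt; apply/orP; left; apply/eqP; ring.
have EX : `|Phi X| <= 2 * T * b1.
  apply: le_trans (@normr_Rintegral_le _ _ _ _ b1 _ _ _) _.
  - by rewrite ltW// gtrN.
  - by apply: cP; exact: sqr_ge0.
  - by move=> u uT; apply: hP; rewrite ler_norml.
  - by rewrite le_eqVlt; apply/orP; left; apply/eqP; ring.
have -> : \int[mu]_(u in `[- T, T]) P 0 u = Phi 0 by rewrite /Phi expr0n.
have -> : Phi 0 = Phi X - (Phi X - Phi 0) by ring.
apply: le_trans (ler_normB _ _) _; exact: lerD.
Qed.

End holomorphy.

(** * Bounded holomorphic functions on the closed right half-plane *)

Section bounded_holomorphy.
Context {R : realType}.
Implicit Types P Q A B : R -> R -> R.

(** The bound on the derivative is what [contour_bound] asks for; the bound on the function itself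
    makes the class stable under products. *)
Definition bhol P Q := bnd2 P Q /\ exists A B, hol P Q A B /\ bnd2 A B.

Lemma bholM P Q P' Q' : bhol P Q -> bhol P' Q' ->
  bhol (fun s u => P s u * P' s u - Q s u * Q' s u)
       (fun s u => P s u * Q' s u + Q s u * P' s u).
Proof.
move=> [b [A [B [h bA]]]] [b' [A' [B' [h' bA']]]]; split; first exact: bnd2M.
by do 2 eexists; split; [exact: holM h h'|apply: bnd2D; exact: bnd2M].
Qed.

Lemma bhol_cst c : bhol (fun _ _ => c) (fun _ _ => 0).
Proof.
split; first by exists `|c| => s u _; rewrite normr0.
do 2 eexists; split; first exact: hol_cst.
by exists 0 => s u _; rewrite normr0.
Qed.

Lemma bholD P Q P' Q' : bhol P Q -> bhol P' Q' ->
  bhol (fun s u => P s u + P' s u) (fun s u => Q s u + Q' s u).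
Proof.
move=> [b [A [B [h bA]]]] [b' [A' [B' [h' bA']]]]; split; first exact: bnd2D.
by do 2 eexists; split; [exact: holD h h'|exact: bnd2D].
Qed.

Lemma bholZ c P Q : bhol P Q -> bhol (fun s u => c * P s u) (fun s u => c * Q s u).
Proof.
move=> [b [A [B [h bA]]]]; split; first exact: bnd2Z.
by do 2 eexists; split; [exact: holZ h|exact: bnd2Z].
Qed.

Lemma bholV P Q A B : hol P Q A B -> bnd2 A B ->
  (forall s u : R, 0 <= s -> P s u ^+ 2 + Q s u ^+ 2 != 0) ->
  bnd2 (invP P Q) (invQ P Q) -> bhol (invP P Q) (invQ P Q).
Proof.
move=> h bA n0 bV; split => //; do 2 eexists; split; first exact: holV h n0.
have [M hM] := bnd2M bA (bnd2M bV bV); exists M => s u s0.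
have [m1 m2] := hM s u s0; rewrite !normrN.
set p := invP P Q s u in m1 m2 *; set q := invQ P Q s u in m1 m2 *; split.
  by apply: le_trans m1; rewrite le_eqVlt; apply/orP; left; apply/eqP; congr `|_|; ring.
by apply: le_trans m2; rewrite le_eqVlt; apply/orP; left; apply/eqP; congr `|_|; ring.
Qed.

Lemma sqr_normr (x : R) : `|x| ^+ 2 = x ^+ 2.
Proof. by rewrite real_normK ?num_real. Qed.

Lemma expR_le1 (x : R) : x <= 0 -> expR x <= 1.
Proof. by move=> x0; rewrite -expR0 ler_expR. Qed.

Lemma norm_expPQ (t s u : R) :
  `|expP t s u| <= expR (- (t * s)) /\ `|expQ t s u| <= expR (- (t * s)).
Proof.
rewrite /expP /expQ normrN !normrM ger0_norm ?expR_ge0//.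
by split; apply: ler_piMr; rewrite ?expR_ge0// ?cos_max ?sin_max.
Qed.

Lemma norm_expPQ_le1 (t s u : R) : 0 <= t -> 0 <= s ->
  `|expP t s u| <= 1 /\ `|expQ t s u| <= 1.
Proof.
move=> t0 s0; have [a b] := norm_expPQ t s u.
have e : expR (- (t * s)) <= 1 by rewrite expR_le1// oppr_le0 mulr_ge0.
by split; apply: le_trans e.
Qed.

Lemma bhol_exp (t : R) : 0 <= t -> bhol (expP t) (expQ t).
Proof.
move=> t0.
have b : bnd2 (expP t) (expQ t) by exists 1 => s u s0; exact: norm_expPQ_le1.
by split => //; do 2 eexists; split; [exact: hol_exp|exact: bnd2Z].
Qed.

Lemma norm_invPQ P Q (s u : R) : 0 < P s u ^+ 2 + Q s u ^+ 2 ->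
  invP P Q s u ^+ 2 + invQ P Q s u ^+ 2 = (P s u ^+ 2 + Q s u ^+ 2)^-1.
Proof. by move=> /lt0r_neq0 n; rewrite /invP /invQ; field. Qed.

(** The hypothesis reads [|f| >= |(1, s, u)| / k]. The free [r] selects the decay to extract: 1 for
    mere boundedness, the abscissa on the right edge, the ordinate on the horizontal edges. *)
Lemma inv_decay P Q (k s u : R) : 0 < k ->
  1 + s ^+ 2 + u ^+ 2 <= k ^+ 2 * (P s u ^+ 2 + Q s u ^+ 2) ->
  forall r, r ^+ 2 <= 1 + s ^+ 2 + u ^+ 2 ->
  `|invP P Q s u| * `|r| <= k /\ `|invQ P Q s u| * `|r| <= k.
Proof.
move=> k0 h r hr.
have N0 : 0 < P s u ^+ 2 + Q s u ^+ 2.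
  rewrite -(pmulr_rgt0 _ (exprn_gt0 2 k0)); apply: lt_le_trans h.
  by rewrite -addrA ltr_pwDl// addr_ge0// sqr_ge0.
have := norm_invPQ N0; move: (invP _ _ _ _) (invQ _ _ _ _) => x y xy.
have H : (x ^+ 2 + y ^+ 2) * r ^+ 2 <= k ^+ 2.
  rewrite xy mulrC ler_pdivrMr//; exact: le_trans hr h.
have r0 := sqr_ge0 r; have x0 := sqr_ge0 x; have y0 := sqr_ge0 y.
have aux z : z ^+ 2 * r ^+ 2 <= k ^+ 2 -> `|z| * `|r| <= k.
  move=> hz; have zr : 0 <= `|z| * `|r| by rewrite mulr_ge0.
  by rewrite -(@ler_pXn2r _ 2) ?nnegrE// ?exprMn ?sqr_normr// ltW.
by split; apply: aux; apply: le_trans H; rewrite mulrDl ?lerDl ?lerDr mulr_ge0.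
Qed.

End bounded_holomorphy.

(** * The characteristic function of the delay equation and its contour estimates *)

Section delay.
Context {R : realType}.
Local Notation mu := (@lebesgue_measure R).
Variables (l tau : R).
Hypotheses (l0 : 0 < l) (tau0 : 0 <= tau) (ltau : tau * l < pi / 2).

(** [delP] and [delQ] are the real and imaginary parts of [p] at [s + iu]. *)
Definition delP (s u : R) := s + l * expP tau s u.
Definition delQ (s u : R) := u + l * expQ tau s u.

Lemma hol_del : exists A B, hol delP delQ A B /\ bnd2 A B.
Proof.
do 2 eexists; split; first exact: (holD hol_id (holZ l (hol_exp tau))).
apply: bnd2D; first by exists 1 => s u _; rewrite normr1 normr0.
apply: bnd2Z; apply: bnd2Z; exact: (bhol_exp tau0).1.
Qed.

(** If [|u| <= l + d], the phase [tau u] stays strictly inside the right half-circle and the real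
    part is bounded below. If [|u| > l + d], the delay term, of modulus at most [l], cannot cancel
    [u] in the imaginary part. *)
Lemma del_lb : exists2 c : R, 0 < c &
  forall s u : R, 0 <= s -> c <= delP s u ^+ 2 + delQ s u ^+ 2.
Proof.
have t1 : 0 < 1 + tau by rewrite ltr_pwDl.
(* The margin left by [tau l < pi/2], scaled so that [tau (l + d)] is still below [pi/2]; dividing
   by [1 + tau] rather than [tau] covers [tau = 0]. *)
pose d := (pi / 2 - tau * l) / (1 + tau).
have d0 : 0 < d by rewrite divr_gt0// subr_gt0.
have td : tau * (l + d) < pi / 2.
  have : d * (1 + tau) = pi / 2 - tau * l by rewrite /d mulfVK// gt_eqF.
  by lra.
have td0 : 0 <= tau * (l + d) by rewrite mulr_ge0// addr_ge0 ?ltW.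
have pi0 : 0 < (pi : R) := pi_gt0 R.
pose k := cos (tau * (l + d)).
have k0 : 0 < k by apply: cos_gt0_pihalf; apply/andP; split => //; lra.
(* For [s >= 1] the term [s] alone gives 1; for [s < 1] the delay term has modulus at least
   [l e^{-tau}] and cosine at least [k]. *)
pose m := Num.min 1 (l * expR (- tau) * k).
have m0 : 0 < m by rewrite lt_min ltr01 !mulr_gt0// expR_gt0.
exists (Num.min (m ^+ 2) (d ^+ 2)); first by rewrite lt_min !exprn_gt0.
move=> s u s0; rewrite ge_min.
have e0 : 0 < expR (- (tau * s)) by exact: expR_gt0.
have [ul|ul] := leP `|u| (l + d); apply/orP; [left|right].
  have ck : k <= cos (tau * u).
    rewrite -[cos (tau * u)]cos_norm normrM (ger0_norm tau0) /k.
    have h : tau * `|u| <= tau * (l + d) by rewrite ler_wpM2l.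
    by rewrite leNgt ltr_cos -?leNgt// in_itv/=; apply/andP; split;
      rewrite ?mulr_ge0 ?addr_ge0 ?(ltW l0) ?(ltW d0)//; lra.
  have mP : m <= delP s u.
    rewrite /delP /expP ge_min; apply/orP.
    have pos : 0 <= l * (expR (- (tau * s)) * cos (tau * u)).
      by rewrite !mulr_ge0 ?ltW// (lt_le_trans k0).
    have [s1|s1] := leP 1 s; [left|right]; first by rewrite -[1]addr0 lerD.
    have et : expR (- tau) <= expR (- (tau * s)).
      by rewrite ler_expR lerN2 -[leRHS]mulr1 ler_wpM2l// ltW.
    have ek : expR (- tau) * k <= expR (- (tau * s)) * cos (tau * u).
      by rewrite ler_pM ?expR_ge0 ?(ltW k0).
    have := ler_wpM2l (ltW l0) ek; rewrite !mulrA => H; apply: le_trans H _.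
    by rewrite lerDr.
  by rewrite -[leLHS]addr0 lerD ?sqr_ge0// ler_sqr ?nnegrE ?(ltW m0)// (le_trans _ mP)// ltW.
have [_ q] := norm_expPQ_le1 u tau0 s0.
have dQ : d <= `|delQ s u|.
  have := lerB_normD u (l * expQ tau s u); rewrite -/(delQ s u) => h.
  apply: le_trans h; rewrite normrM (gtr0_norm l0).
  have : l * `|expQ tau s u| <= l * 1 by rewrite ler_wpM2l// ltW.
  by lra.
by rewrite -[leLHS]add0r lerD ?sqr_ge0// -(sqr_normr (delQ s u)) ler_sqr ?nnegrE ?(ltW d0).
Qed.

(** Far from 0, [p(s)] differs from [s] by at most [l] in modulus; elsewhere the uniform lower bound
    absorbs the constants. *)
Lemma del_coercive : exists2 k : R, 0 < k & forall s u : R, 0 <= s ->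
  1 + s ^+ 2 + u ^+ 2 <= k ^+ 2 * (delP s u ^+ 2 + delQ s u ^+ 2).
Proof.
have [c c0 hc] := del_lb.
(* From [s^2 <= 2 P^2 + 2 l^2] and the same for [u], the left side is at most [2 |p|^2 + 1 + 4 l^2],
   and [1 <= |p|^2 / c]. Then [K <= (K + 1)^2] provides the square. *)
pose K := 2 + (1 + 4 * l ^+ 2) / c.
have K0 : 0 < K by rewrite ltr_pwDl// divr_ge0 ?ltW// ltr_pwDl// mulr_ge0// sqr_ge0.
exists (K + 1); first by rewrite ltr_pwDr// ltW.
move=> s u s0.
have [e1 e2] := norm_expPQ_le1 u tau0 s0.
have N := hc s u s0.
set p := delP s u in N *; set q := delQ s u in N *.
have aux z e : `|e| <= 1 -> z ^+ 2 <= 2 * (z + l * e) ^+ 2 + 2 * l ^+ 2.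
  move=> e1'; have : e ^+ 2 <= 1 by rewrite -sqr_normr -[leRHS](expr1n _ 2) ler_sqr ?nnegrE.
  move=> /(ler_wpM2l (sqr_ge0 l)) h.
  have := sqr_ge0 (z + 2 * (l * e)); nra.
have h1 := aux s _ e1; have h2 := aux u _ e2.
rewrite -/(delP s u) -/p in h1; rewrite -/(delQ s u) -/q in h2.
have h3 : 1 + s ^+ 2 + u ^+ 2 <= K * (p ^+ 2 + q ^+ 2).
  rewrite /K mulrDl mulrAC -mulrA.
  have : (1 + 4 * l ^+ 2) * 1 <= (1 + 4 * l ^+ 2) * ((p ^+ 2 + q ^+ 2) / c).
    rewrite ler_wpM2l//; last by rewrite ler_pdivlMr// mul1r.
    by rewrite addr_ge0// mulr_ge0// sqr_ge0.
  by lra.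
apply: le_trans h3 _; rewrite ler_wpM2r//; last by nra.
by rewrite addr_ge0// sqr_ge0.
Qed.

Lemma del_neq0 (s u : R) : 0 <= s -> delP s u ^+ 2 + delQ s u ^+ 2 != 0.
Proof.
move=> s0; have [c c0 hc] := del_lb.
by rewrite gt_eqF// (lt_le_trans c0)// hc.
Qed.

Lemma bhol_del : bhol (invP delP delQ) (invQ delP delQ).
Proof.
have [A [B [h b]]] := hol_del.
apply: (bholV h b del_neq0).
have [k k0 hk] := del_coercive; exists k => s u s0.
have [] := inv_decay k0 (hk s u s0) (r := 1); rewrite ?normr1 ?mulr1//.
by rewrite expr1n -addrA lerDl addr_ge0// sqr_ge0.
Qed.

(** Square [e^{y/2} >= y/2]. Quadratic decay at [y = t X^2] beats the length [2 X^3] of the right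
    edge by a factor X. *)
Lemma expRN_le (y : R) : 0 < y -> expR (- y) <= 4 / y ^+ 2.
Proof.
move=> y0; rewrite expRN -[4 / _]invrK lef_pV2 ?posrE ?expR_gt0//; last first.
  by rewrite invr_gt0 divr_gt0// exprn_gt0.
rewrite invf_div.
have -> : expR y = expR (y / 2) ^+ 2 by rewrite expr2 -expRD -splitr.
have h := expR_ge1Dx (y / 2).
have -> : y ^+ 2 / 4 = (y / 2) ^+ 2 by field.
rewrite ler_sqr ?nnegrE ?expR_ge0//; last by rewrite divr_ge0 ?ltW.
by apply: le_trans h; rewrite lerDr.
Qed.

(** [shiftP] and [shiftQ] are the real and imaginary parts of [e^{-tz} / p(z)] at [z = s + iu]. *)
Definition shiftP (t s u : R) := expP t s u * invP delP delQ s u - expQ t s u * invQ delP delQ s u.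
Definition shiftQ (t s u : R) := expP t s u * invQ delP delQ s u + expQ t s u * invP delP delQ s u.

(** With width [X^2] and ordinates [- X^3] and [X^3], the horizontal edges contribute [X^2] times
    O(X^-3), the right edge [X^3] times O(X^-4). Only the latter depends on [t], through [1 / t^2],
    hence the uniformity for [t >= e]. *)
Lemma shift_contour (e : R) : 0 < e -> exists2 C : R, 0 <= C &
  forall t X : R, e <= t -> 1 <= X ->
  `|\int[mu]_(u in `[- X ^+ 3, X ^+ 3]) shiftP t 0 u| <= C / X.
Proof.
move=> e0; have [k k0 hk] := del_coercive.
exists (16 * k / e ^+ 2 + 8 * k).
  by rewrite addr_ge0 ?divr_ge0 ?mulr_ge0 ?sqr_ge0// ltW.
move=> t X et X1.
have X0 : 0 < X by exact: lt_le_trans X1.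
have t0 : 0 < t by exact: lt_le_trans et.
have [_ [A [B [h b]]]] := bholM (bhol_exp (ltW t0)) bhol_del.
have X3 : 0 < X ^+ 3 by exact: exprn_gt0.
have hl (r s u : R) : 0 <= s -> r ^+ 2 <= 1 + s ^+ 2 + u ^+ 2 ->
   (`|shiftP t s u| * `|r| <= 2 * (expR (- (t * s)) * k)) /\
   (`|shiftQ t s u| * `|r| <= 2 * (expR (- (t * s)) * k)).
  move=> s0 /(inv_decay k0 (hk s u s0)).
  have [e1 e2] := norm_expPQ t s u.
  rewrite /shiftP /shiftQ; move: (expP _ _ _) (expQ _ _ _) (invP _ _ _ _) (invQ _ _ _ _) e1 e2.
  move=> a a' x x' e1 e2 [h1 h2].
  have f1 : `|a| * (`|x| * `|r|) <= expR (- (t * s)) * k by rewrite ler_pM ?mulr_ge0.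
  have f2 : `|a| * (`|x'| * `|r|) <= expR (- (t * s)) * k by rewrite ler_pM ?mulr_ge0.
  have f3 : `|a'| * (`|x| * `|r|) <= expR (- (t * s)) * k by rewrite ler_pM ?mulr_ge0.
  have f4 : `|a'| * (`|x'| * `|r|) <= expR (- (t * s)) * k by rewrite ler_pM ?mulr_ge0.
  have g1 := ler_wpM2r (normr_ge0 r) (ler_normB (a * x) (a' * x')).
  have g2 := ler_wpM2r (normr_ge0 r) (ler_normD (a * x') (a' * x)).
  by rewrite !normrM in g1 g2; split; nra.
have /(_ (4 / (t * X ^+ 2) ^+ 2 * (2 * k)) (2 * k / X ^+ 3)) := contour_bound h b X0 X3.
rewrite -/(shiftP t) -/(shiftQ t) => H; apply: le_trans (H _ _) _.
- move=> u _; have [] := hl 1 (X ^+ 2) u (sqr_ge0 _).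
    by rewrite expr1n -addrA lerDl addr_ge0// sqr_ge0.
  rewrite normr1 mulr1 => /le_trans + _; apply.
  rewrite mulrCA; apply: ler_wpM2r; first by rewrite mulr_ge0 ?ltW.
  by apply: expRN_le; rewrite mulr_gt0// exprn_gt0.
- move=> s /andP[s0 _].
  have ek : 2 * (expR (- (t * s)) * k) <= 2 * k.
    rewrite ler_pM2l//; apply: ler_piMl; first exact: ltW.
    by apply: expR_le1; rewrite oppr_le0 mulr_ge0// ltW.
  have aux u : `|u| = X ^+ 3 -> `|shiftQ t s u| <= 2 * k / X ^+ 3.
    move=> uX; have [|_ q] := hl u s u s0; first by rewrite lerDr addr_ge0// sqr_ge0.
    by rewrite ler_pdivlMr// -uX (le_trans q).
  by split; apply: aux; rewrite ?normrN gtr0_norm.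
- rewrite [leRHS]mulrDl lerD//; last first.
    by rewrite le_eqVlt; apply/orP; left; apply/eqP; field; rewrite gt_eqF.
  have -> : 2 * X ^+ 3 * (4 / (t * X ^+ 2) ^+ 2 * (2 * k)) = (16 * k / X) * (t ^+ 2)^-1.
    by field; rewrite !gt_eqF.
  have -> : 16 * k / e ^+ 2 / X = 16 * k / X * (e ^+ 2)^-1.
    by field; rewrite !gt_eqF.
  apply: ler_wpM2l; first by rewrite divr_ge0 ?mulr_ge0 ?ltW.
  by rewrite lef_pV2 ?posrE ?exprn_gt0// ler_sqr ?nnegrE ?(ltW e0) ?(ltW t0).
Qed.

(** The real and imaginary parts of [1 + s], in the unreduced shape that [holD] produces from
    [hol_cst] and [hol_id]. *)
Definition addP (s u : R) := 1 + s.
Definition addQ (s u : R) : R := 0 + u.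

(* [(1 - l e^{-tau s}) / (p(s) (1 + s)) = 1/p(s) - 1/(1+s)] is [O(1/s^2)]. *)
Lemma residue_contour : exists2 C : R, 0 <= C & forall X : R, 1 <= X ->
  `|\int[mu]_(u in `[- X ^+ 3, X ^+ 3])
      (l * cos (tau * u) / (delP 0 u ^+ 2 + delQ 0 u ^+ 2) - (1 + u ^+ 2)^-1)| <= C / X.
Proof.
have [k k0 hk] := del_coercive.
have ha s u : 0 <= s -> 1 + s ^+ 2 + u ^+ 2 <= 1 ^+ 2 * (addP s u ^+ 2 + addQ s u ^+ 2).
  by move=> s0; rewrite /addP /addQ; nra.
have badd : bhol (invP addP addQ) (invQ addP addQ).
  apply: (bholV (holD (hol_cst 1) hol_id)).
  - by apply: bnd2D; exists 1 => s u _; rewrite ?normr1 ?normr0.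
  - move=> s u s0; rewrite gt_eqF//; apply: lt_le_trans (_ : 1 + s ^+ 2 + u ^+ 2 <= _).
      by rewrite -addrA ltr_pwDl// addr_ge0// sqr_ge0.
    by have := ha s u s0; rewrite expr1n mul1r.
  - exists 1 => s u s0.
    have [] := inv_decay ltr01 (ha s u s0) (r := 1); rewrite ?normr1 ?mulr1//.
    by rewrite expr1n -addrA lerDl addr_ge0// sqr_ge0.
have bnum : bhol (fun s u => 1 + - l * expP tau s u) (fun s u => 0 + - l * expQ tau s u).
  by apply: bholD; [exact: bhol_cst|apply: bholZ; exact: bhol_exp].
have [_ [A [B [h b]]]] := bholM bnum (bholM bhol_del badd).
set P := (fun s u : R => (_ * _ : R) - _) in h.
set Q := (fun s u : R => (_ * _ : R) + _) in h.
(* Each part of the triple product expands into four real terms; times [r^2], each is at most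
   [1 + l] for the numerator, times [k] for [1/p], times 1 for [1/(1+s)]. *)
pose K := 4 * ((1 + l) * k).
have K0 : 0 <= K by rewrite !mulr_ge0 ?addr_ge0 ?ltW.
have hl (r s u : R) : 0 <= s -> r ^+ 2 <= 1 + s ^+ 2 + u ^+ 2 ->
   (`|P s u| * r ^+ 2 <= K) /\ (`|Q s u| * r ^+ 2 <= K).
  move=> s0 hr; have [v1 v2] := inv_decay k0 (hk s u s0) hr.
  have [w1 w2] := inv_decay ltr01 (ha s u s0) hr.
  have [e1 e2] := norm_expPQ_le1 u tau0 s0.
  have le (x : R) : `|x| <= 1 -> `|- l * x| <= l.
    by move=> x1; rewrite normrM normrN (gtr0_norm l0); apply: ler_piMr => //; exact: ltW.
  have n1 : `|1 + - l * expP tau s u| <= 1 + l.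
    by apply: le_trans (ler_normD _ _) _; rewrite normr1 lerD2l le.
  have n2 : `|0 + - l * expQ tau s u| <= 1 + l.
    by rewrite add0r; apply: le_trans (le _ e2) _; rewrite lerDr.
  rewrite /P /Q /=.
  move: (1 + _) (0 + _) (invP delP _ _ _) (invQ delP _ _ _)
    (invP addP _ _ _) (invQ addP _ _ _) n1 n2 v1 v2 w1 w2.
  move=> a a' x x' y y' n1 n2 v1 v2 w1 w2.
  have f c z w : `|c| <= 1 + l -> `|z| * `|r| <= k -> `|w| * `|r| <= 1 ->
     `|c * (z * w)| * r ^+ 2 <= (1 + l) * k.
    move=> c1 z1 wr; rewrite !normrM -sqr_normr.
    have -> : `|c| * (`|z| * `|w|) * `|r| ^+ 2 = `|c| * ((`|z| * `|r|) * (`|w| * `|r|)) by ring.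
    by rewrite ler_pM ?mulr_ge0// -[leRHS]mulr1 ler_pM ?mulr_ge0.
  have g (z1 z2 z3 z4 : R) : `|z1| * r ^+ 2 <= (1 + l) * k -> `|z2| * r ^+ 2 <= (1 + l) * k ->
     `|z3| * r ^+ 2 <= (1 + l) * k -> `|z4| * r ^+ 2 <= (1 + l) * k ->
     `|(z1 - z2) - (z3 + z4)| * r ^+ 2 <= K /\ `|(z1 + z2) + (z3 - z4)| * r ^+ 2 <= K.
    move=> i1 i2 i3 i4; have r0 := sqr_ge0 r.
    have j1 := ler_wpM2r r0 (ler_normB (z1 - z2) (z3 + z4)).
    have j2 := ler_wpM2r r0 (ler_normB z1 z2).
    have j3 := ler_wpM2r r0 (ler_normD z3 z4).
    have j4 := ler_wpM2r r0 (ler_normD (z1 + z2) (z3 - z4)).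
    have j5 := ler_wpM2r r0 (ler_normD z1 z2).
    have j6 := ler_wpM2r r0 (ler_normB z3 z4).
    by rewrite /K; rewrite !mulrDl in j1 j2 j3 j4 j5 j6; split; lra.
  split.
    have [+ _] := g _ _ _ _ (f a x y n1 v1 w1) (f a x' y' n1 v2 w2)
      (f a' x y' n2 v1 w2) (f a' x' y n2 v2 w1).
    by rewrite !mulrBr !mulrDr.
  have [_ +] := g _ _ _ _ (f a x y' n1 v1 w2) (f a x' y n1 v2 w1)
    (f a' x y n2 v1 w1) (f a' x' y' n2 v2 w2).
  by rewrite !mulrBr !mulrDr.
exists (2 * K + 4 * K); first by rewrite addr_ge0// mulr_ge0.
move=> X X1.
have X0 : 0 < X by exact: lt_le_trans X1.
have X3 : 0 < X ^+ 3 by exact: exprn_gt0.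
have := contour_bound h b X0 X3 (b1 := K / X ^+ 4) (b2 := K / X ^+ 6).
(* On the imaginary axis the real part of [1/p] is [l cos(tau u) / |p|^2] and that of [1/(1 + iu)]
   is [1/(1 + u^2)]. *)
have -> : P 0 = fun u => l * cos (tau * u) / (delP 0 u ^+ 2 + delQ 0 u ^+ 2) - (1 + u ^+ 2)^-1.
  apply/funext => u; have n := del_neq0 u (lexx 0); move: n.
  rewrite /P /invP /invQ /delP /delQ /addP /addQ /expP /expQ mulr0 oppr0 expR0 !mul1r.
  rewrite !addr0 !add0r expr1n => n.
  have m : 1 + u ^+ 2 != 0 by rewrite gt_eqF// ltr_pwDl// sqr_ge0.
  by field; rewrite n m.
move=> H; apply: le_trans (H _ _) _.
- move=> u _; have [|q _] := hl (X ^+ 2) (X ^+ 2) u (sqr_ge0 _).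
    by rewrite addrAC lerDr addr_ge0// sqr_ge0.
  by rewrite ler_pdivlMr ?exprn_gt0//; move: q; rewrite -exprM.
- move=> s /andP[s0 _].
  have aux u : `|u| = X ^+ 3 -> `|Q s u| <= K / X ^+ 6.
    move=> uX; have [|_ q] := hl u s u s0; first by rewrite lerDr addr_ge0// sqr_ge0.
    by rewrite ler_pdivlMr ?exprn_gt0//; move: q; rewrite -sqr_normr uX -exprM.
  by split; apply: aux; rewrite ?normrN gtr0_norm.
- have -> : 2 * X ^+ 3 * (K / X ^+ 4) + 4 * X ^+ 2 * (K / X ^+ 6) = 2 * K / X + 4 * K / X ^+ 4.
    by field; rewrite gt_eqF.
  rewrite [leRHS]mulrDl lerD2l; apply: ler_wpM2l; first by rewrite mulr_ge0.
  rewrite lef_pV2 ?posrE ?exprn_gt0//.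
  by rewrite -[leLHS]expr1 ler_weXn2l.
Qed.

End delay.

(** * Integrals over the line as limits of truncations *)

Section line_integrals.
Context {R : realType}.
Local Notation mu := (@lebesgue_measure R).

Lemma oneDsqrV_integral :
  mu.-integrable setT (EFin \o (fun u : R => (1 + u ^+ 2)^-1)) /\
  \int[mu]_u (1 + u ^+ 2)^-1 = pi.
Proof.
have c : continuous (fun u : R => (1 + u ^+ 2)^-1) := @continuous_oneDsqrV R.
have p (u : R) : 0 <= (1 + u ^+ 2)^-1 by rewrite invr_ge0 addr_ge0// sqr_ge0.
have E : (\int[mu]_u ((1 + u ^+ 2)^-1)%:E = pi%:E)%E.
  rewrite (ge0_symfun_integralT p c); last by move=> x; rewrite /= sqrrN.
  rewrite (_ : [set x | _] = `[0, +oo[%classic); last first.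
    by apply/seteqP; split => x/=; rewrite in_itv/= andbT.
  have := @integral0y_oneDsqr R; rewrite /oneDsqr => ->.
  by rewrite -EFinM mulrCA divff// mulr1.
split; last by rewrite /Rintegral E.
apply/integrableP; split.
  by apply/measurable_EFinP; exact: continuous_measurable_fun.
under eq_integral => u _ do rewrite /= ger0_norm//.
by rewrite E ltry.
Qed.

(** The half-height [X^3] of the rectangles at [X = k + 1], a sequence that meets the condition
    [1 <= X] from the start. *)
Definition cube (k : nat) : R := k.+1%:R ^+ 3.

Lemma cvg_Rintegral_cube (g : R -> R) : mu.-integrable setT (EFin \o g) ->
  (\int[mu]_(u in `[- cube k, cube k]) g u) @[k --> \oo] --> \int[mu]_u g u.
Proof.
move=> ig; have /integrableP[mg _] := ig.
have -> : (fun k => \int[mu]_(u in `[- cube k, cube k]) g u) =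
  fine \o (fun k => (\int[mu]_(u in setT) ((g \_ `[- cube k, cube k]) u)%:E)%E).
  by apply/funext => k; rewrite Rintegral_mkcond.
apply: fine_cvg.
rewrite /Rintegral fineK; last by apply: integrable_fin_num.
apply: (@dominated_cvg _ _ _ mu _ _ _ _ (fun u => `|(g u)%:E|%E)) => //.
- move=> k; apply/measurable_EFinP.
  apply/(measurable_restrictT g) => //.
  by apply: measurable_funS (iffLR (measurable_EFinP _ _) mg).
- move=> x _; apply: cvg_near_cst; near=> k.
  rewrite patchE ifT// inE/= in_itv/=.
  rewrite -ler_norml; apply: le_trans (_ : k%:R <= _).
    by near: k; exact: nbhs_infty_ger.
  rewrite /cube; apply: le_trans (_ : k.+1%:R <= _); first by rewrite ler_nat.
  by rewrite -[leLHS]expr1 ler_weXn2l// ler1n.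
- exact: integrable_abse.
- move=> k x _; rewrite lee_fin patchE; case: ifPn => // _.
  by rewrite normr0.
Unshelve. all: by end_near. Qed.

Lemma cvg_harmonic_mul (C : R) : C / k.+1%:R @[k --> \oo] --> (0 : R).
Proof.
rewrite -[X in _ --> X](mulr0 C); apply: cvgM; first exact: cvg_cst.
exact: cvg_harmonic.
Qed.

End line_integrals.

(** * Closed form of the scalar delay integral *)

Section delay_integral.
Context {R : realType}.
Local Notation mu := (@lebesgue_measure R).
Variables (l tau : R).
Hypotheses (l0 : 0 < l) (tau0 : 0 <= tau) (ltau : tau * l < pi / 2).

Let f (u : R) := (l ^+ 2 + u ^+ 2 - 2 * l * u * sin (tau * u))^-1.

Lemma del_sqr (u : R) : delP l tau 0 u ^+ 2 + delQ l tau 0 u ^+ 2 =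
  l ^+ 2 + u ^+ 2 - 2 * l * u * sin (tau * u).
Proof.
rewrite /delP /delQ /expP /expQ mulr0 oppr0 expR0 !mul1r.
by have := cos2sin2 (tau * u); move: (cos _) (sin _) => c s h; ring: h.
Qed.

Lemma delay_den_neq0 (u : R) : l ^+ 2 + u ^+ 2 - 2 * l * u * sin (tau * u) != 0.
Proof. by rewrite -del_sqr del_neq0. Qed.

Lemma continuous_mulcst (a x : R) : {for x, continuous (fun u : R => a * u)}.
Proof. exact: is_derive_continuous (is_derive_lin a x). Qed.

Lemma delay_kernel_continuous : continuous f.
Proof.
move=> u; apply: cvgV; first exact: delay_den_neq0.
have cs := is_derive_continuous (is_derive_sinl tau u).
apply: cvgB; last by apply: cvgM => //; exact: continuous_mulcst.
by apply: cvgD; [exact: cvg_cst|exact: exprn_continuous].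
Qed.

Lemma delay_kernel_le : exists2 K : R, 0 <= K & forall u, 0 <= f u <= K * (1 + u ^+ 2)^-1.
Proof.
have [k k0 hk] := del_coercive l0 tau0 ltau.
exists (k ^+ 2); first exact: sqr_ge0.
move=> u; have := hk 0 u (lexx 0); rewrite del_sqr expr0n addr0 => h.
have u0 : 0 < 1 + u ^+ 2 by rewrite ltr_pwDl// sqr_ge0.
have N0 : 0 < l ^+ 2 + u ^+ 2 - 2 * l * u * sin (tau * u).
  by rewrite -(pmulr_rgt0 _ (exprn_gt0 2 k0)) (lt_le_trans u0).
by rewrite /f invr_ge0 ltW//= ler_pdivlMr// mulrC ler_pdivrMr.
Qed.

Lemma cos_kernel_continuous (t : R) : continuous (fun u => cos (t * u) * f u).
Proof.
move=> u; apply: cvgM; last exact: delay_kernel_continuous.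
exact: is_derive_continuous (is_derive_cosl t u).
Qed.

Lemma norm_cos_kernel (t u : R) : `|cos (t * u) * f u| <= f u.
Proof.
have [K _ /(_ u)/andP[f0 _]] := delay_kernel_le.
by rewrite normrM (ger0_norm f0) ler_piMl// cos_max.
Qed.

Lemma delay_kernel_integrable : mu.-integrable setT (EFin \o f).
Proof.
have [K K0 fK] := delay_kernel_le.
apply: (@le_integrable _ _ _ mu setT _ _ (EFin \o (fun u : R => K * (1 + u ^+ 2)^-1))) => //.
- by apply/measurable_EFinP; apply: continuous_measurable_fun; exact: delay_kernel_continuous.
- move=> u _; have /andP[f0 f1] := fK u.
  by rewrite /= lee_fin !ger0_norm// (le_trans f0).
- exact: (integrableZl measurableT K (@oneDsqrV_integral R).1).
Qed.

Lemma cos_kernel_integrable (t : R) : mu.-integrable setT (EFin \o (fun u => cos (t * u) * f u)).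
Proof.
apply: (@le_integrable _ _ _ mu setT _ _ (EFin \o f)) => //; last exact: delay_kernel_integrable.
- by apply/measurable_EFinP; apply: continuous_measurable_fun; exact: cos_kernel_continuous.
- move=> u _; rewrite lee_fin; apply: le_trans (norm_cos_kernel t u) _; exact: ler_norm.
Qed.

(** Only the truncation [r] is differentiated: the kernel [u sin(tu) f(u)] is merely O(1/|u|), which
    is not dominated on the whole line. *)
Let r (T t : R) := \int[mu]_(u in `[- T, T]) (cos (t * u) * f u).
Let rho (t : R) := \int[mu]_u (cos (t * u) * f u).

Lemma cvg_truncated_rho (t : R) : r (cube k) t @[k --> \oo] --> rho t.
Proof. exact: cvg_Rintegral_cube (cos_kernel_integrable t). Qed.

Lemma rho_continuous : continuous rho.
Proof.
move=> t.
apply: (@continuity_under_integral _ _ _ mu _ setT _ (t - 1) (t + 1) _ _ f) => //.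
- by move=> y _; exact: cos_kernel_integrable.
- apply/aeW => u _ y _; apply: cvgM; last exact: cvg_cst.
  have := is_derive_continuous (is_derive_cosl u y).
  rewrite (_ : (fun z => cos (u * z)) = (fun z => cos (z * u)))//.
  by apply/funext => z; rewrite mulrC.
- exact: delay_kernel_integrable.
- by move=> y _; apply/aeW => u _; exact: norm_cos_kernel.
- by rewrite inE/= in_itv/= ltrDl ltr01 gtrBl ltr01.
Qed.

Lemma is_derive_truncated_rho (T t : R) :
  is_derive t 1 (r T) (\int[mu]_(u in `[- T, T]) (- (u * sin (t * u)) * f u)).
Proof.
have [K K0 fK] := delay_kernel_le.
apply: (@is_derive_under_Rintegral _ (fun t u => cos (t * u) * f u)
   (fun t u => - (u * sin (t * u)) * f u) _ _ _ (t - 1) (t + 1) (`|T| * K)).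
- by rewrite ltrDl ltr01 gtrBl ltr01.
- exact: cos_kernel_continuous.
- move=> y u.
  have -> : (fun z => cos (z * u) * f u) = (fun z => f u * cos (u * z)).
    by apply/funext => z; rewrite mulrC [u * z]mulrC.
  apply: is_derive_eq (is_deriveZ (f u) (is_derive_cosl u y)) _.
  by rewrite /GRing.scale/= mulrC [u * y]mulrC.
- move=> y u _ uT; have /andP[f0 f1] := fK u.
  rewrite !normrM normrN normrM ler_pM ?mulr_ge0//.
    rewrite -[leRHS]mulr1 ler_pM ?sin_max//.
    apply: le_trans (ler_norm T); by rewrite ler_norml.
  rewrite ger0_norm//; apply: le_trans f1 _; rewrite -[leRHS]mulr1 ler_wpM2l//.
  by rewrite invf_le1 ?lerDl ?sqr_ge0// ltr_pwDl// sqr_ge0.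
Qed.

(** On the imaginary axis [1/p] is [f] times the conjugate [- iu + l e^{i tau u}] of [p]. Multiplied
    by [e^{-itu}], its two summands have the two integrands on the left as real parts. The right
    side is thus the defect of the truncation in the delay equation. *)
Lemma truncated_rho_shift (T t : R) :
  \int[mu]_(u in `[- T, T]) (- (u * sin (t * u)) * f u) + l * r T (tau - t) =
  \int[mu]_(u in `[- T, T]) shiftP l tau t 0 u.
Proof.
have c1 : continuous (fun u : R => - (u * sin (t * u)) * f u).
  move=> u; apply: cvgM; last exact: delay_kernel_continuous.
  apply: cvgN; apply: cvgM; first exact: cvg_id.
  exact: is_derive_continuous (is_derive_sinl t u).
have c2 : continuous (fun u : R => l * (cos ((tau - t) * u) * f u)).
  by move=> u; apply: cvgM; [exact: cvg_cst|exact: cos_kernel_continuous].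
rewrite /r -RintegralZl//; last by apply: continuous_itv_integrable; exact: cos_kernel_continuous.
rewrite -RintegralD//; [|exact: continuous_itv_integrable..].
apply: eq_Rintegral => u _.
rewrite mulrBl cosB /shiftP /invP /invQ del_sqr -/(f u) /delP /delQ /expP /expQ.
by rewrite !mulr0 oppr0 expR0; ring.
Qed.

(* The autocorrelation [rho] satisfies the delay equation
   [rho' t = - l rho (tau - t)], so this combination is a first integral. *)
Let a (T t : R) := r T t * cos (l * t) + r T (tau - t) * sin (l * t).

(** The terms carrying [l] cancel in pairs, leaving the defects at [t] and [tau - t]. *)
Lemma is_derive_first_integral (T t : R) : is_derive t 1 (a T)
  (cos (l * t) * (\int[mu]_(u in `[- T, T]) shiftP l tau t 0 u)
   - sin (l * t) * (\int[mu]_(u in `[- T, T]) shiftP l tau (tau - t) 0 u)).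
Proof.
have d1 := is_derive_truncated_rho T t.
have dt : is_derive t 1 (fun y => tau - y) (- 1).
  by apply: is_derive_eq (is_deriveB (is_derive_cst tau t 1) (is_derive_id t 1)) _; rewrite sub0r.
have d2 := is_derive1_comp (f := r T) (g := fun y => tau - y)
  (is_derive_truncated_rho T (tau - t)) dt.
apply: is_derive_eq (is_deriveD (is_deriveM d1 (is_derive_cosl l t))
  (is_deriveM d2 (is_derive_sinl l t))) _.
rewrite -!truncated_rho_shift subKr /GRing.scale/=; ring.
Qed.

(** A point [c] of [[e, tau - e]] has both [c] and [tau - c] at least [e], so one contour constant
    controls both defects in the mean value theorem. *)
Lemma first_integral (e : R) : 0 < e -> e < tau - e ->
  rho (tau - e) * cos (l * (tau - e)) + rho e * sin (l * (tau - e)) =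
  rho e * cos (l * e) + rho (tau - e) * sin (l * e).
Proof.
move=> e0 et; have [C C0 hC] := shift_contour l0 tau0 ltau e0.
have cva t : a (cube k) t @[k --> \oo] --> rho t * cos (l * t) + rho (tau - t) * sin (l * t).
  by apply: cvgD; apply: cvgM; try exact: cvg_cst; exact: cvg_truncated_rho.
have := cvgB (cva (tau - e)) (cva e); rewrite subKr => h1.
apply/eqP; rewrite -subr_eq0; apply/eqP.
have h2 : a (cube k) (tau - e) - a (cube k) e @[k --> \oo] --> (0 : R).
  apply: norm_cvg0.
  (* Two defects of size at most [C / (k + 1)] over an interval no longer than [tau]. *)
  apply: (@squeeze_cvgr _ _ _ _ (cst 0) (fun k => (C + C) * tau / k.+1%:R));
    last exact: cvg_harmonic_mul.
    apply/nearW => k; rewrite normr_ge0/=.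
    have [|c] := @MVT _ (a (cube k)) _ e (tau - e) et
      (fun x _ => is_derive_first_integral (cube k) x).
      by apply: continuous_subspaceT => x;
        exact: is_derive_continuous (is_derive_first_integral _ x).
    rewrite in_itv/= => /andP[ec ct] ->.
    have k1 : 1 <= k.+1%:R :> R by rewrite ler1n.
    have i1 := hC c _ (ltW ec) k1.
    have et2 : e <= tau - c by lra.
    have i2 := hC _ _ et2 k1.
    rewrite normrM; have -> : (C + C) * tau / k.+1%:R = (C / k.+1%:R + C / k.+1%:R) * tau by ring.
    apply: ler_pM => //; last by rewrite ger0_norm; lra.
    apply: le_trans (ler_normB _ _) _; rewrite !normrM.
    by apply: lerD; rewrite -[leRHS]mul1r ler_pM ?cos_max ?sin_max.
  exact: cvg_cst.
by rewrite -(cvg_lim (@Rhausdorff R) h2); apply/esym/(cvg_lim (@Rhausdorff R)); exact: h1.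
Qed.

(** The limit of [first_integral] as [e] decreases to 0. *)
Lemma rho_endpoints : rho 0 * (1 - sin (l * tau)) = rho tau * cos (l * tau).
Proof.
(* For [tau = 0] no [e] is admissible, but the identity is immediate. *)
have [->|] := eqVneq tau 0; first by rewrite mulr0 sin0 cos0 subr0.
move=> tn0; have tp : 0 < tau by rewrite lt_def tn0.
pose D e := (rho (tau - e) * cos (l * (tau - e)) + rho e * sin (l * (tau - e)))
  - (rho e * cos (l * e) + rho (tau - e) * sin (l * e)).
have cl e : {for e, continuous (fun y : R => cos (l * y))}.
  exact: is_derive_continuous (is_derive_cosl l e).
have sl e : {for e, continuous (fun y : R => sin (l * y))}.
  exact: is_derive_continuous (is_derive_sinl l e).
have ct : continuous (fun e : R => tau - e).
  by move=> e; apply: cvgB; [exact: cvg_cst|exact: cvg_id].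
have cr e : {for e, continuous (fun e : R => rho (tau - e))}.
  by apply: continuous_comp; [exact: ct|exact: rho_continuous].
have clt e : {for e, continuous (fun y : R => cos (l * (tau - y)))}.
  by apply: (@continuous_comp _ _ _ (fun y : R => tau - y)
    (fun y : R => cos (l * y))); [exact: ct|exact: cl].
have slt e : {for e, continuous (fun y : R => sin (l * (tau - y)))}.
  by apply: (@continuous_comp _ _ _ (fun y : R => tau - y)
    (fun y : R => sin (l * y))); [exact: ct|exact: sl].
have cD : {for 0, continuous D}.
  by apply: cvgB; apply: cvgD; apply: cvgM; try exact: rho_continuous;
    first [exact: cr|exact: cl|exact: sl|exact: clt|exact: slt].
have D0 : D 0 = 0.
  have h0 : D e @[e --> 0^'+] --> D 0 by apply: cvg_at_right_filter; exact: cD.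
  apply: (cvg_unique _ h0) => //; apply: cvg_near_cst; near=> e.
  rewrite /D first_integral ?subrr//.
  suff : e < tau / 2 by lra.
  by near: e; apply: nbhs_right_lt; rewrite divr_gt0.
move: D0; rewrite /D subr0 !mulr0 sin0 cos0; lra.
Unshelve. all: by end_near. Qed.

(** The conservation law is homogeneous in [rho]; comparison with [1/(1+s)] supplies its
    normalisation. *)
Lemma rho_tau : l * rho tau = pi.
Proof.
have [C C0 hC] := residue_contour l0 tau0 ltau.
have [iD ID] := @oneDsqrV_integral R.
have E : (fun u => l * cos (tau * u) / (delP l tau 0 u ^+ 2 + delQ l tau 0 u ^+ 2)
     - (1 + u ^+ 2)^-1)
   = (fun u => l * (cos (tau * u) * f u) - (1 + u ^+ 2)^-1).
  by apply/funext => u; rewrite del_sqr mulrA.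
have i1 : mu.-integrable setT (EFin \o (fun u => l * (cos (tau * u) * f u))).
  exact: (integrableZl measurableT l (cos_kernel_integrable tau)).
have i2 : mu.-integrable setT (EFin \o (fun u => l * (cos (tau * u) * f u) - (1 + u ^+ 2)^-1)).
  exact: (integrableB measurableT i1 iD).
have h1 := cvg_Rintegral_cube i2.
rewrite RintegralB// RintegralZl// in h1; last exact: cos_kernel_integrable.
rewrite -/(rho tau) ID in h1.
apply/eqP; rewrite -subr_eq0; apply/eqP.
apply: (cvg_unique _ h1) => //.
apply: norm_cvg0.
apply: (@squeeze_cvgr _ _ _ _ (cst 0) (fun k => C / k.+1%:R)); last exact: cvg_harmonic_mul.
  by apply/nearW => k; rewrite normr_ge0/= -E; apply: hC; rewrite ler1n.
exact: cvg_cst.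
Qed.

Lemma sin_ltau_lt1 : sin (l * tau) < 1.
Proof.
have c0 : 0 < cos (l * tau).
  apply: cos_gt0_pihalf; rewrite [l * tau]mulrC ltau andbT.
  apply: lt_le_trans (_ : 0 <= _); last by rewrite mulr_ge0// ltW.
  by rewrite oppr_lt0 divr_gt0// pi_gt0.
have := cos2Dsin2 (l * tau); have := sin_max (l * tau); rewrite ler_norml.
move: (cos _) (sin _) c0 => c s c0 /andP[_ s1] h; rewrite lt_neqAle s1 andbT.
by apply/eqP => sE; move: h; rewrite sE; nra.
Qed.

Lemma delay_integral : mu.-integrable setT (EFin \o f) /\
  \int[mu]_u f u = pi * (l^-1 * cos (l * tau) / (1 - sin (l * tau))).
Proof.
split; first exact: delay_kernel_integrable.
have -> : \int[mu]_u f u = rho 0.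
  by apply: eq_Rintegral => u _; rewrite mul0r cos0 mul1r.
have s1 : 1 - sin (l * tau) != 0 by rewrite subr_eq0 eq_sym lt_eqF// sin_ltau_lt1.
have h1 := rho_endpoints; have h2 := rho_tau.
have ln : l != 0 by rewrite gt_eqF.
have -> : rho 0 = rho tau * cos (l * tau) / (1 - sin (l * tau)) by rewrite -h1 mulfK.
by rewrite -h2; field; rewrite s1 ln.
Qed.

End delay_integral.

(** * Functional calculus of a diagonalised matrix *)

Section functional_calculus.
Variables (F : fieldType) (n : nat) (P : 'M[F]_n).
Hypothesis Pu : P \in unitmx.
Implicit Types e : 'I_n -> F.

Definition fc e : 'M[F]_n := invmx P *m diag_mx (\row_k e k) *m P.

Lemma fcE e i j : fc e i j = \sum_k invmx P i k * e k * P k j.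
Proof.
by rewrite /fc mxE; apply: eq_bigr => k _; rewrite mul_mx_diag !mxE.
Qed.

Lemma eq_fc e e' : e =1 e' -> fc e = fc e'.
Proof. by move=> ee; congr (_ *m diag_mx _ *m _); apply/rowP => k; rewrite !mxE ee. Qed.

Lemma fcM e e' : fc e *m fc e' = fc (fun k => e k * e' k).
Proof.
rewrite /fc !mulmxA mulmxK// -(mulmxA (invmx P) (diag_mx _) (diag_mx _)) mulmx_diag.
congr (_ *m diag_mx _ *m _).
by apply/rowP => k; rewrite !mxE.
Qed.

Lemma fcD e e' : fc e + fc e' = fc (fun k => e k + e' k).
Proof.
by apply/matrixP => i j; rewrite mxE !fcE -big_split; apply: eq_bigr => k _; rewrite mulrDr mulrDl.
Qed.

Lemma fcZ c e : c *: fc e = fc (fun k => c * e k).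
Proof.
by apply/matrixP => i j; rewrite mxE !fcE mulr_sumr; apply: eq_bigr => k _; ring.
Qed.

Lemma fcB e e' : fc e - fc e' = fc (fun k => e k - e' k).
Proof.
rewrite -scaleN1r fcZ fcD; apply: eq_fc => k; by rewrite mulN1r.
Qed.

Lemma fc1 : fc (fun=> 1) = 1%:M.
Proof.
rewrite /fc (_ : diag_mx _ = 1%:M) ?mulmx1 ?mulVmx//.
by apply/matrixP => i j; rewrite !mxE.
Qed.

Lemma fc0 : fc (fun=> 0) = 0.
Proof. by apply/matrixP => i j; rewrite fcE mxE big1// => k _; rewrite mulr0 mul0r. Qed.

Lemma fcX e m : fc e ^+ m = fc (fun k => e k ^+ m).
Proof.
elim: m => [|m IH]; first by rewrite expr0 -[LHS]fc1; apply: eq_fc => k.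
by rewrite exprS IH [LHS]fcM; apply: eq_fc => k; rewrite exprS.
Qed.

Lemma fc_inv e : (forall k, e k != 0) -> invmx (fc e) = fc (fun k => (e k)^-1).
Proof.
move=> e0; have E : fc e *m fc (fun k => (e k)^-1) = 1%:M.
  by rewrite fcM -fc1; apply: eq_fc => k; rewrite divff.
have [u _] := mulmx1_unit E.
by rewrite -[RHS]mul1mx -(mulVmx u) -mulmxA E mulmx1.
Qed.

(** [P^-1 D P] is symmetric exactly when [D] commutes with [P P^T]; the hypothesis is this
    commutation, entry by entry. *)
Lemma fc_tr e : (forall k m, (P *m P^T) k m * (e m - e k) = 0) -> (fc e)^T = fc e.
Proof.
move=> S.
have C : P *m P^T *m diag_mx (\row_k e k) = diag_mx (\row_k e k) *m (P *m P^T).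
  apply/matrixP => k m; rewrite mul_mx_diag mul_diag_mx !mxE [RHS]mulrC.
  by apply/eqP; rewrite -subr_eq0 -mulrBr; apply/eqP; have := S k m; rewrite !mxE.
rewrite /fc !trmx_mul tr_diag_mx -[RHS]mulmxA.
apply: (can_inj (mulKmx Pu)); rewrite !mulKVmx// !mulmxA C.
by rewrite -!mulmxA -trmx_mul mulVmx// trmx1 mulmx1.
Qed.

End functional_calculus.

(** * Uniqueness of the Moore-Penrose inverse *)

Section pseudo_inverse.
Variables (R : realType).

(** [A X] and [A Y] are symmetric and each absorbs the other, so transposing their product
    identifies them; likewise for [X A] and [Y A]. *)
Lemma penrose_unique m n (A : 'M[R]_(m, n)) X Y : penrose A X -> penrose A Y -> X = Y.
Proof.
move=> [x1 x2 x3 x4] [y1 y2 y3 y4].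
have E : A *m X = A *m Y.
  by rewrite -{1}y1 -mulmxA -y3 -x3 -trmx_mul mulmxA x1 y3.
have E' : X *m A = Y *m A.
  have -> : X *m A = X *m A *m (Y *m A) by rewrite -mulmxA (mulmxA A Y) y1.
  by rewrite -x4 -y4 -trmx_mul -(mulmxA Y A) (mulmxA A X) x1 y4.
by rewrite -x2 -mulmxA E mulmxA E' y2.
Qed.

Lemma mp_pinvE m n (A : 'M[R]_(m, n)) X : penrose A X -> mp_pinv A = X.
Proof. by move=> h; apply: xget_unique => // Y hY; exact: penrose_unique hY h. Qed.

End pseudo_inverse.

(** * Real diagonalisation of symmetric matrices *)

Section symmetric.
Variables (R : realType) (n : nat).

Lemma map_mx_RRe (A : 'M[complex R]_n) : A \is a realmx -> exists B, A = mxC B.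
Proof.
move=> /mxOverP h; exists (map_mx (@complex.Re R) A).
by apply/matrixP => i j; rewrite !mxE; apply/esym/RRe_real/h.
Qed.

(** The complex spectral theorem gives a unitary conjugation to a real diagonal matrix.
    [real_similar] replaces it by a real conjugation, about which only invertibility is retained. *)
Lemma symmetric_diagonalizable (A : 'M[R]_n) : A^T = A ->
  exists (P : 'M[R]_n) (d : 'I_n -> R), P \in unitmx /\ A = fc P d.
Proof.
move=> At; pose B : 'M[complex R]_n := mxC A.
have Br : B \is a realmx by apply/mxOverP => i j; rewrite mxE; apply/complex_realP; exists (A i j).
have Bs : B \is symmetricmx.
  apply/is_hermitianmxP; rewrite expr0 scale1r map_mx_id//.
  by rewrite /B /mxC -[in LHS]At map_trmx.
have Bh := realsym_hermsym Bs Br.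
have /orthomx_spectralP BE := hermitian_normalmx Bh.
have Dr := hermitian_spectral_diag_real Bh.
set D := spectral_diag B in BE Dr.
have Dr' : diag_mx D \is a realmx.
  apply/mxOverP => i j; rewrite mxE; case: (i == j); rewrite ?mulr1n ?mulr0n ?real0//.
  by have /mxOverP := Dr; apply.
have [] := @real_similar _ _ B (diag_mx D) _ Br Dr'.
  exists (spectralmx B); first exact: spectral_unit.
  apply/similarP; first exact: spectral_unit.
  have := congr1 (mulmx (spectralmx B)) BE.
  by rewrite !mulmxA mulmxV ?spectral_unit// mul1mx.
move=> Q; rewrite inE => /andP[/map_mx_RRe[P ->] Pu] /(similarP Pu) E.
have Pu' : P \in unitmx by move: Pu; rewrite /mxC (map_unitmx (real_complex R)).
exists P, (fun k => complex.Re (D 0 k)); split => //.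
apply: (can_inj (mulKmx Pu')); rewrite /fc !mulmxA mulmxV// mul1mx.
have inj : injective (@map_mx _ _ (real_complex R) n n).
  by apply: map_mx_inj; exact: complexI.
apply: inj; rewrite !map_mxM; apply: etrans E _; congr (_ *m _).
apply/matrixP => i j; rewrite !mxE; case: eqP => [->|_]; rewrite ?mulr1n ?mulr0n.
  by rewrite [RHS]RRe_real//; have /mxOverP := Dr; apply.
by [].
Qed.

End symmetric.

(** * Dirichlet form and kernel of the Laplacian *)

Section laplacian_theory.
Variables (R : realType) (n : nat) (a : 'M[R]_n).
Hypotheses (wg : weighted_graph a) (gc : graph_connected a).
Local Notation L := (laplacian a).

Lemma laplacian_sym : L^T = L.
Proof.
have [s _] := wg; apply/matrixP => i j; rewrite !mxE s; congr (_ - _).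
by rewrite eq_sym; case: eqP => [->|].
Qed.

Lemma laplacian_mul_col (v : 'cV[R]_n) i :
  (L *m v) i 0 = \sum_j a i j * (v i 0 - v j 0).
Proof.
rewrite /laplacian mulmxBl mxE /degmx mul_diag_mx !mxE mulr_suml -sumrB.
by apply: eq_bigr => j _; rewrite mulrBr.
Qed.

Lemma laplacian_const : L *m const_mx 1 = 0 :> 'cV[R]_n.
Proof.
apply/matrixP => i j; rewrite ord1 laplacian_mul_col !mxE big1// => k _.
by rewrite !mxE subrr mulr0.
Qed.

(** Averaging the double sum with its copy under exchange of [i] and [j] completes the square. *)
Lemma laplacian_quad (v : 'cV[R]_n) :
  (v^T *m L *m v) 0 0 = 2^-1 * \sum_i \sum_j a i j * (v i 0 - v j 0) ^+ 2.
Proof.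
have [s _] := wg.
have E : (v^T *m L *m v) 0 0 = \sum_i \sum_j a i j * (v i 0 * (v i 0 - v j 0)).
  rewrite -mulmxA mxE; apply: eq_bigr => i _.
  rewrite laplacian_mul_col mxE mulr_sumr; apply: eq_bigr => j _; ring.
have E' : (v^T *m L *m v) 0 0 = \sum_i \sum_j a i j * (v j 0 * (v j 0 - v i 0)).
  by rewrite E exchange_big; apply: eq_bigr => i _; apply: eq_bigr => j _; rewrite s.
have : (v^T *m L *m v) 0 0 + (v^T *m L *m v) 0 0 = \sum_i \sum_j a i j * (v i 0 - v j 0) ^+ 2.
  rewrite {1}E E' -big_split; apply: eq_bigr => i _ /=.
  by rewrite -big_split; apply: eq_bigr => j _ /=; ring.
by move=> <-; field.
Qed.

Lemma laplacian_quad_ge0 (v : 'cV[R]_n) : 0 <= (v^T *m L *m v) 0 0.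
Proof.
have [_ [p _]] := wg.
rewrite laplacian_quad mulr_ge0 ?invr_ge0//; apply: sumr_ge0 => i _.
by apply: sumr_ge0 => j _; rewrite mulr_ge0 ?sqr_ge0.
Qed.

(** Every term of the vanishing Dirichlet form is zero, so [v] agrees across each edge, hence along
    each path. *)
Lemma laplacian_ker (v : 'cV[R]_n) : L *m v = 0 -> forall i j, v i 0 = v j 0.
Proof.
have [_ [p _]] := wg.
move=> Lv0 i j.
have : (v^T *m L *m v) 0 0 = 0 by rewrite -mulmxA Lv0 mulmx0 mxE.
rewrite laplacian_quad => /eqP; rewrite mulf_eq0 invr_eq0 pnatr_eq0/= => /eqP.
have pos k m : 0 <= a k m * (v k 0 - v m 0) ^+ 2 by rewrite mulr_ge0 ?sqr_ge0.
move=> /(psumr_eq0P (fun k _ => sumr_ge0 _ (fun m _ => pos k m))) h.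
have step k m : 0 < a k m -> v k 0 = v m 0.
  move=> akm; have /(psumr_eq0P (fun m _ => pos k m))/(_ m isT)/eqP := h k isT.
  by rewrite mulf_eq0 gt_eqF//= sqrf_eq0 subr_eq0 => /eqP.
have /connectP[s ps ->] := gc i j.
by elim: s i ps => //= k s IH i /andP[ik ps]; rewrite (step _ _ ik) IH.
Qed.

End laplacian_theory.

(** * Spectrum of the Laplacian and functions of it *)

Section spectral_laplacian.
Variables (R : realType) (n : nat) (a : 'M[R]_n) (tau : R).
Hypotheses (wg : weighted_graph a) (gc : graph_connected a).
Local Notation L := (laplacian a).
Variables (P : 'M[R]_n) (d : 'I_n -> R).
Hypotheses (Pu : P \in unitmx) (LE : L = fc P d).

Lemma spectral_row k : row k P *m L = d k *: row k P.
Proof.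
rewrite -row_mul LE /fc !mulmxA mulmxV// mul1mx.
by apply/rowP => j; rewrite [LHS]mxE mul_diag_mx !mxE.
Qed.

Lemma spectral_row_neq0 k : row k P != 0.
Proof.
apply/eqP => h; have /(congr1 (fun B => (row k B) 0 k)) := mulmxV Pu.
by rewrite row_mul h mul0mx !mxE eqxx => /esym/eqP; rewrite oner_eq0.
Qed.

Lemma eigenvalue_spectral k : eigenvalue L (d k).
Proof.
by apply/eigenvalueP; exists (row k P); [exact: spectral_row|exact: spectral_row_neq0].
Qed.

Lemma spectral_ge0 k : 0 <= d k.
Proof.
have := laplacian_quad_ge0 wg (row k P)^T; rewrite trmxK spectral_row -scalemxAl mxE.
rewrite pmulr_lge0// mxE lt_def sumr_ge0 ?andbT; last by move=> i _; rewrite !mxE -expr2 sqr_ge0.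
apply: contra (spectral_row_neq0 k) => /eqP h; apply/eqP/rowP => j.
have pos (i : 'I_n) : true -> 0 <= row k P 0 i * (row k P)^T i 0.
  by move=> _; rewrite [X in _ * X]mxE -expr2 sqr_ge0.
have /(_ j isT)/eqP := psumr_eq0P pos h.
by rewrite [X in _ * X]mxE mulf_eq0 orbb => /eqP ->; rewrite mxE.
Qed.

Lemma spectral_le_lambda_max k : d k <= lambda_max L.
Proof.
apply: ub_le_sup; last exact: eigenvalue_spectral.
(* [sup] needs an upper bound: each eigenvalue is some [d m], found at a nonzero coordinate of [v]
   in the eigenbasis, and the other [d i] are nonnegative. *)
exists (\sum_i d i) => x /eigenvalueP[v vL v0].
have [m m0] : exists m, (v *m invmx P) 0 m != 0.
  apply/existsP; apply: contraNT v0 => /existsPn h.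
  rewrite -(mulmxKV Pu v); suff -> : v *m invmx P = 0 by rewrite mul0mx.
  by apply/rowP => j; have := h j; rewrite negbK mxE => /eqP ->; rewrite mxE.
have : v *m invmx P *m diag_mx (\row_i d i) = x *: (v *m invmx P).
  rewrite scalemxAl -vL LE /fc !mulmxA mulmxK//.
move=> /matrixP/(_ 0 m); rewrite mul_mx_diag !mxE => /eqP.
rewrite [x * _]mulrC -subr_eq0 -mulrBr mulf_eq0 subr_eq0.
have -> : (\sum_j v 0 j * invmx P j m == 0) = false.
  by apply/negbTE; move: m0; rewrite mxE.
move=> /eqP <-; rewrite (bigD1 m)//= lerDl; apply: sumr_ge0 => i _; exact: spectral_ge0.
Qed.

(** Symmetry of [L] makes rows of [P] with distinct eigenvalues orthogonal; within one eigenspace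
    nothing is claimed. *)
Lemma spectral_gram k m : (P *m P^T) k m * (d m - d k) = 0.
Proof.
pose D := diag_mx (\row_i d i).
have PL : P *m L = D *m P by rewrite LE /fc !mulmxA mulmxV// mul1mx.
have C : P *m P^T *m D = D *m (P *m P^T).
  have -> : P *m P^T *m D = (D *m P *m P^T)^T.
    by rewrite !trmx_mul trmxK tr_diag_mx mulmxA.
  by rewrite -PL !trmx_mul trmxK laplacian_sym// mulmxA PL -mulmxA.
have /matrixP/(_ k m) := C; rewrite mul_mx_diag mul_diag_mx !mxE => E.
by rewrite mulrBr E; ring.
Qed.

(** A function of the eigenvalue is constant on each eigenspace, so it commutes with the
    block-diagonal Gram matrix. *)
Lemma fc_spectral_sym (g : R -> R) : (fc P (g \o d))^T = fc P (g \o d).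
Proof.
apply: (fc_tr Pu) => k m /=; have /eqP := spectral_gram k m.
rewrite mulf_eq0 subr_eq0 => /orP[/eqP ->|/eqP ->]; first by rewrite mul0r.
by rewrite subrr mulr0.
Qed.

(** With [0^-1 = 0], pointwise inversion on the spectrum satisfies the Penrose equations;
    [g x / g x] is the indicator of [g x != 0]. *)
Lemma mp_pinv_spectral (g : R -> R) :
  mp_pinv (fc P (g \o d)) = fc P (fun k => (g (d k))^-1).
Proof.
have gV : fc P (g \o d) *m fc P (fun k => (g (d k))^-1) = fc P ((fun x => g x / g x) \o d).
  by rewrite fcM.
have Vg : fc P (fun k => (g (d k))^-1) *m fc P (g \o d) = fc P ((fun x => g x / g x) \o d).
  by rewrite fcM//; apply: eq_fc => k /=; rewrite mulrC.
apply: mp_pinvE; split.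
- rewrite gV fcM//; apply: eq_fc => k /=.
  by have [->|nz] := eqVneq (g (d k)) 0; rewrite ?mulr0// mulfVK.
- rewrite Vg fcM//; apply: eq_fc => k /=.
  by have [->|nz] := eqVneq (g (d k)) 0; rewrite ?invr0 ?mulr0// divff// mul1r.
- by rewrite gV fc_spectral_sym.
- by rewrite Vg fc_spectral_sym.
Qed.

Definition nz (x : R) : R := (x != 0)%:R.

(* The spectral projection on the kernel is symmetric with constant rows, hence
   a multiple of the all-ones matrix; it fixes the all-ones vector. *)
Lemma Mn_spectral : Mn R n = fc P (nz \o d).
Proof.
pose Z := fc P ((fun x => 1 - nz x) \o d).
have Zb : fc P (nz \o d) = 1%:M - Z.
  by rewrite -(fc1 Pu) fcB; apply: eq_fc => k /=; rewrite subKr.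
have LZ : L *m Z = 0.
  rewrite LE fcM// -(fc0 P); apply: eq_fc => k /=; rewrite /nz.
  by have [->|_] := eqVneq (d k) 0; rewrite ?mul0r// subrr mulr0.
have Zc i j k : Z i j = Z k j.
  have Lc : L *m col j Z = 0 by rewrite colE mulmxA LZ mul0mx.
  by have := laplacian_ker wg gc Lc i k; rewrite !mxE.
have Zt : Z^T = Z := fc_spectral_sym (fun x => 1 - nz x).
have Zs i j : Z i j = Z j i by rewrite -[in LHS]Zt mxE.
have Z1 : Z *m const_mx 1 = const_mx 1 :> 'cV[R]_n.
  have : fc P (nz \o d) *m const_mx 1 = 0 :> 'cV[R]_n.
    (* The complementary projection factors through [L], which kills constants. *)
    have -> : fc P (nz \o d) = fc P (fun k => (d k)^-1) *m L.
      rewrite LE fcM//; apply: eq_fc => k /=; rewrite /nz.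
      by have [->|h] := eqVneq (d k) 0; rewrite ?mulr0// mulVf.
    by rewrite -mulmxA laplacian_const mulmx0.
  by rewrite Zb mulmxBl mul1mx => /eqP; rewrite subr_eq0 => /eqP <-.
rewrite Zb /Mn; congr (_ - _); apply/matrixP => i j.
have n0 : n%:R != 0 :> R by rewrite pnatr_eq0 -lt0n (leq_ltn_trans _ (ltn_ord i)).
have /matrixP/(_ i 0) := Z1; rewrite [LHS]mxE [RHS]mxE.
have -> : \sum_j0 Z i j0 * (const_mx 1 : 'cV[R]_n) j0 0 = Z i j * n%:R.
  have Zk k : Z i k * (const_mx 1 : 'cV[R]_n) k 0 = Z i j.
    by rewrite [X in _ * X]mxE mulr1 (Zs i k) (Zc k i j) (Zs j i).
  by under eq_bigr => k _ do rewrite Zk; rewrite sumr_const card_ord mulr_natr.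
by move=> E; rewrite [LHS]mxE mxE mulr1 -[Z i j](mulfK n0) E mul1r.
Qed.

End spectral_laplacian.

(** * Matrix cosine and sine through the spectrum *)

Section matrix_series.
Variables (R : realType) (n : nat) (P : 'M[R]_n) (e : 'I_n -> R).
Hypothesis Pu : P \in unitmx.

(** Each entry of the matrix series is a fixed finite combination of the scalar series at the
    eigenvalues. *)
Lemma cvg_fc_series (c : nat -> R) (p : nat -> nat) (y : 'I_n -> R) i j :
  (forall k, (fun N => \sum_(0 <= m < N) c m * e k ^+ p m) @ \oo --> y k) ->
  (fun N => \sum_(0 <= m < N) (c m * (fc P e ^+ p m) i j)) @ \oo --> fc P y i j.
Proof.
move=> h; rewrite fcE.
have -> : (fun N => \sum_(0 <= m < N) (c m * (fc P e ^+ p m) i j)) =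
   (fun N => \sum_k (invmx P i k * (\sum_(0 <= m < N) c m * e k ^+ p m) * P k j)).
  apply/funext => N.
  under [RHS]eq_bigr => k _ do rewrite mulr_sumr mulr_suml.
  rewrite [RHS]exchange_big; apply: eq_bigr => m _ /=.
  rewrite fcX// fcE mulr_sumr; apply: eq_bigr => k _; ring.
apply: cvg_big => [|k _]; first exact: add_continuous.
apply: cvgM; last exact: cvg_cst.
by apply: cvgM; [exact: cvg_cst|exact: h].
Qed.

Lemma matcos_fc : matcos (fc P e) = fc P (cos \o e).
Proof.
apply/matrixP => i j; rewrite mxE; apply: (cvg_lim (@Rhausdorff R)).
apply: (@cvg_fc_series (fun m => (-1) ^+ m / ((2 * m)`!)%:R) (fun m => 2 * m)%N) => k.
rewrite (_ : (fun N => _) = series (cos_coeff' (e k))); first exact: cvg_cos_coeff'.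
apply/funext => N; rewrite /series /=.
by apply: eq_bigr => m _; rewrite /cos_coeff' -exprnP mul2n mulrAC.
Qed.

Lemma matsin_fc : matsin (fc P e) = fc P (sin \o e).
Proof.
apply/matrixP => i j; rewrite mxE; apply: (cvg_lim (@Rhausdorff R)).
apply: (@cvg_fc_series (fun m => (-1) ^+ m / ((2 * m).+1`!)%:R) (fun m => (2 * m).+1)%N) => k.
rewrite (_ : (fun N => _) = series (sin_coeff' (e k))); first exact: cvg_sin_coeff'.
apply/funext => N; rewrite /series /=.
by apply: eq_bigr => m _; rewrite /sin_coeff' -exprnP mul2n mulrAC.
Qed.

End matrix_series.

Lemma map_fc (F F' : fieldType) (f : {rmorphism F -> F'}) n (P : 'M[F]_n) (e : 'I_n -> F) :
  map_mx f (fc P e) = fc (map_mx f P) (f \o e).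
Proof.
rewrite /fc !map_mxM map_invmx; congr (_ *m _ *m _).
by apply/matrixP => i j; rewrite !mxE rmorphMn.
Qed.

(** * Modal decomposition of the transfer matrix and of [rho_ss] *)

Section transfer.
Variables (R : realType) (n : nat) (a : 'M[R]_n) (tau : R).
Hypotheses (wg : weighted_graph a) (gc : graph_connected a).
Hypotheses (tau0 : 0 <= tau) (tl : tau * lambda_max (laplacian a) < pi / 2).
Local Notation L := (laplacian a).
Local Notation C := (complex R).
Local Notation mu := (@lebesgue_measure R).
Variables (P : 'M[R]_n) (d : 'I_n -> R).
Hypotheses (Pu : P \in unitmx) (LE : L = fc P d).

(** The squared modulus, at nonzero frequency, of the response [modal_gain] of the mode with
    eigenvalue [x]; it is 0 on the consensus mode, which [M_n] projects out. *)
Definition gain (w x : R) : R :=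
  if x == 0 then 0 else (x ^+ 2 + w ^+ 2 - 2 * x * w * sin (tau * w))^-1.

Definition char_fun (w x : R) : C :=
  Complex 0 w + Complex (cos (w * tau)) (- sin (w * tau)) * real_complex R x.

Lemma tau_spectral k : tau * d k < pi / 2.
Proof.
apply: le_lt_trans tl; rewrite ler_wpM2l//; exact: (spectral_le_lambda_max wg Pu LE).
Qed.

Lemma char_funE w x :
  char_fun w x = Complex (cos (tau * w) * x) (w - sin (tau * w) * x).
Proof.
rewrite /char_fun [w * tau]mulrC; apply/eqP; rewrite eq_complex /=.
by apply/andP; split; apply/eqP; ring.
Qed.

Lemma char_fun_sqr w x : (cos (tau * w) * x) ^+ 2 + (w - sin (tau * w) * x) ^+ 2 =
  x ^+ 2 + w ^+ 2 - 2 * x * w * sin (tau * w).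
Proof. by have := cos2sin2 (tau * w); move: (cos _) (sin _) => c s h; ring: h. Qed.

Lemma spectral_gt0 k : d k != 0 -> 0 < d k.
Proof. by move=> k0; rewrite lt_def k0 (spectral_ge0 wg Pu LE). Qed.

(** At eigenvalue 0 the value is [iw], which is why [w != 0] is assumed; at a positive eigenvalue it
    is [p(iw)]. *)
Lemma char_fun_neq0 (w : R) k : w != 0 -> char_fun w (d k) != 0.
Proof.
move=> w0; rewrite char_funE; apply/eqP => -[h1 h2].
have := char_fun_sqr w (d k); rewrite h1 h2 expr0n addr0.
have [->|k0] := eqVneq (d k) 0.
  by rewrite expr0n mulr0 !mul0r add0r subr0 => /esym/eqP; rewrite sqrf_eq0 (negbTE w0).
move=> /esym/eqP; apply/negP.
exact: (delay_den_neq0 (spectral_gt0 k0) tau0 (tau_spectral k)).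
Qed.

Definition modal_gain (w x : R) : C := real_complex R (nz x) / char_fun w x.

Lemma modal_gain_sqr (w : R) k : w != 0 ->
  conjc (modal_gain w (d k)) * modal_gain w (d k) = real_complex R (gain w (d k)).
Proof.
move=> w0; have c0 := char_fun_neq0 k w0.
have cj (x : R) (z : C) : conjc (real_complex R x / z) = real_complex R x / conjc z.
  by rewrite rmorphM fmorphV; congr (_ * _); exact: conjc_real.
rewrite /modal_gain cj /gain /nz.
have [_|k0] := eqVneq (d k) 0; first by rewrite !mul0r.
have conjM z : z * conjc z = real_complex R (complex.Re z ^+ 2 + complex.Im z ^+ 2) :> C.
  by case: z => x y; apply/eqP; rewrite eq_complex /=; apply/andP; split; apply/eqP; ring.
rewrite rmorph1 !mul1r -invfM [conjc _ * _]mulrC conjM -fmorphV; congr (real_complex R _).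
by rewrite char_funE /= char_fun_sqr.
Qed.

Definition mode_matrix w : 'M[C]_n := fc (mxC P) (modal_gain w \o d).

Lemma mxC_unit : mxC P \in unitmx.
Proof. by rewrite /mxC (map_unitmx (real_complex R)). Qed.

Lemma mxC_fc e : mxC (fc P e) = fc (mxC P) (real_complex R \o e).
Proof. exact: (map_fc (real_complex R)). Qed.

Lemma transfer_resolvent (w : R) : w != 0 ->
  mxC (Mn R n) *m invmx (Complex 0 w *: 1%:M
     + Complex (cos (w * tau)) (- sin (w * tau)) *: mxC L) = mode_matrix w.
Proof.
move=> w0; have Cu := mxC_unit.
have -> : Complex 0 w *: 1%:M + Complex (cos (w * tau)) (- sin (w * tau)) *: mxC L =
  fc (mxC P) (char_fun w \o d).
  rewrite LE mxC_fc -(fc1 Cu) !fcZ fcD; apply: eq_fc => k /=.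
  by rewrite mulr1.
rewrite fc_inv//; last by move=> k; exact: char_fun_neq0.
by rewrite (Mn_spectral wg gc Pu LE) mxC_fc fcM.
Qed.

Lemma adjC_mode_matrix w : adjC (mode_matrix w) = fc (mxC P) (fun k => conjc (modal_gain w (d k))).
Proof.
rewrite /adjC /mode_matrix (map_fc (@conjc R)).
have -> : map_mx (@conjc R) (mxC P) = mxC P.
  by apply/matrixP => i j; rewrite !mxE conjc_real.
apply: (fc_tr mxC_unit) => k m /=.
have -> : (mxC P *m (mxC P)^T) k m = real_complex R ((P *m P^T) k m).
  rewrite !mxE rmorph_sum; apply: eq_bigr => l _; rewrite !mxE rmorphM.
  by [].
have /eqP := spectral_gram wg Pu LE k m.
rewrite mulf_eq0 subr_eq0 => /orP[/eqP ->|/eqP ->]; first by rewrite rmorph0 mul0r.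
by rewrite subrr mulr0.
Qed.

Lemma mode_matrix_sqr (w : R) : w != 0 ->
  adjC (mode_matrix w) *m mode_matrix w = mxC (fc P (gain w \o d)).
Proof.
move=> w0; rewrite adjC_mode_matrix fcM ?mxC_unit// mxC_fc.
by apply: eq_fc => k /=; rewrite modal_gain_sqr.
Qed.

Lemma adjCM m p q (A : 'M[C]_(m, p)) (B : 'M[C]_(p, q)) : adjC (A *m B) = adjC B *m adjC A.
Proof. by rewrite /adjC map_mxM trmx_mul. Qed.

(** [Delta diag(sigma)] is a real diagonal [D], and the trace of [D X D] sees only the diagonal of
    [X]: hence linearity in each [sigma_i^2]. *)
Lemma transfer_trace (sigma : 'I_n -> R) (w : R) : w != 0 ->
  complex.Re (\tr (adjC (Gjw tau a sigma w) *m Gjw tau a sigma w)) =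
  \sum_i (degmx a i i * sigma i) ^+ 2 * fc P (gain w \o d) i i.
Proof.
move=> w0; pose D : 'M[R]_n := diag_mx (\row_i (degmx a i i * sigma i)).
have -> : Gjw tau a sigma w = mode_matrix w *m mxC D.
  rewrite /Gjw transfer_resolvent// -mulmxA; congr (_ *m _).
  have -> : D = degmx a *m diag_mx (\row_i sigma i).
    rewrite /degmx mulmx_diag; congr diag_mx; apply/rowP => i.
    by rewrite !mxE eqxx mulr1n.
  by rewrite /mxC (map_mxM (real_complex R)).
have aD : adjC (mxC D) = mxC D.
  rewrite /adjC; have -> : map_mx (@conjc R) (mxC D) = mxC D.
    by apply/matrixP => i j; rewrite !mxE conjc_real.
  by rewrite /mxC map_trmx tr_diag_mx.
rewrite adjCM aD mulmxA -(mulmxA (mxC D)) mode_matrix_sqr//.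
have -> : mxC D *m mxC (fc P (gain w \o d)) *m mxC D = mxC (D *m fc P (gain w \o d) *m D).
  by rewrite /mxC !(map_mxM (real_complex R)).
have -> : \tr (mxC (D *m fc P (gain w \o d) *m D)) =
    real_complex R (\tr (D *m fc P (gain w \o d) *m D)).
  by rewrite /mxC (trace_map_mx (real_complex R)).
apply: eq_bigr => i _; move: (fc P _) => X.
by rewrite mul_mx_diag mul_diag_mx !mxE; ring.
Qed.

Lemma gain_integral k : mu.-integrable setT (EFin \o (gain ^~ (d k))) /\
  \int[mu]_w gain w (d k) =
  pi * ((d k)^-1 * cos (tau * d k) * (nz (d k) - sin (tau * d k))^-1).
Proof.
rewrite /gain /nz; have [->|k0] := eqVneq (d k) 0.
  (* On the consensus mode both sides vanish, the right one through [0^-1 = 0]. *)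
  rewrite invr0 !mul0r mulr0; split; last by rewrite Rintegral_cst// mul0r.
  exact: integrable0.
rewrite mulr1n [tau * d k]mulrC.
exact: (delay_integral (spectral_gt0 k0) tau0 (tau_spectral k)).
Qed.

Lemma Rintegral_lin (I : finType) (c : I -> R) (g : I -> R -> R) :
  (forall i, mu.-integrable setT (EFin \o g i)) ->
  mu.-integrable setT (EFin \o (fun w => \sum_i c i * g i w)) /\
  \int[mu]_w (\sum_i c i * g i w) = \sum_i c i * \int[mu]_w g i w.
Proof.
move=> ig; elim: (index_enum I) => [|i s [IH1 IH2]].
  have -> : (fun w => \sum_(i <- [::]) c i * g i w) = (fun=> 0 : R).
    by apply/funext => w; rewrite big_nil.
  by rewrite big_nil; split; [exact: integrable0|rewrite Rintegral_cst// mul0r].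
have -> : (fun w => \sum_(j <- i :: s) c j * g j w) =
   (fun w => c i * g i w + \sum_(j <- s) c j * g j w).
  by apply/funext => w; rewrite big_cons.
have iZ := integrableZl measurableT (c i) (ig i).
split; first exact: (integrableD measurableT iZ IH1).
by rewrite big_cons RintegralD// RintegralZl// IH2.
Qed.

(** The value at eigenvalue [x] of the matrix [L^+ cos(tau L) (M_n - sin(tau L))^+]. *)
Definition mode_gain x := x^-1 * cos (tau * x) * (nz x - sin (tau * x))^-1.

Lemma fc_gain_integral i : mu.-integrable setT (EFin \o (fun w => fc P (gain w \o d) i i)) /\
  \int[mu]_w fc P (gain w \o d) i i = pi * fc P (mode_gain \o d) i i.
Proof.
have -> : (fun w => fc P (gain w \o d) i i) =
    (fun w => \sum_k (invmx P i k * P k i) * gain w (d k)).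
  by apply/funext => w; rewrite fcE; apply: eq_bigr => k _ /=; rewrite mulrAC.
have [h1 h2] := Rintegral_lin (fun k => invmx P i k * P k i) (fun k => (gain_integral k).1).
split => //; rewrite h2 fcE mulr_sumr; apply: eq_bigr => k _.
by rewrite (gain_integral k).2 /mode_gain /=; ring.
Qed.

Lemma rho_ssE (sigma : 'I_n -> R) : rho_ss tau a sigma =
  2^-1 * \sum_i (degmx a i i * sigma i) ^+ 2 * fc P (mode_gain \o d) i i.
Proof.
pose F w := complex.Re (\tr (adjC (Gjw tau a sigma w) *m Gjw tau a sigma w)).
pose H w := \sum_i (degmx a i i * sigma i) ^+ 2 * fc P (gain w \o d) i i.
have [iH IH] := Rintegral_lin (fun i => (degmx a i i * sigma i) ^+ 2)
  (fun i => (fc_gain_integral i).1).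
have FH w : w != 0 -> F w = H w by move=> w0; exact: transfer_trace.
have mH : measurable_fun [set: R] H by have /integrableP[/measurable_EFinP] := iH.
have m0 : measurable ([set: R] `\ 0) by apply: measurableD.
have E : {in [set: R] `\ 0, (EFin \o F) =1 (EFin \o H)}.
  by move=> w; rewrite inE => -[_ /= /eqP w0]; rewrite FH.
have mH' : measurable_fun ([set: R] `\ 0) (EFin \o H).
  by apply/measurable_EFinP; exact: measurable_funTS.
have -> : rho_ss tau a sigma = (2 * pi)^-1 * \int[mu]_w H w.
  rewrite /rho_ss /Rintegral; congr (_ * fine _).
  (* The modal formula holds only for [w != 0], so the null set [{0}] is removed from both
     integrals; measurability of [F] off 0 comes from [H]. *)
  rewrite -[LHS](@integral_setD1 _ _ 0)//; last first.
    by apply: (eq_measurable_fun (EFin \o H)) => // w /E.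
  by rewrite -[RHS](@integral_setD1 _ _ 0)//; apply: eq_integral.
rewrite /H IH.
under eq_bigr => i _ do rewrite (fc_gain_integral i).2 mulrCA.
rewrite -mulr_sumr mulrA; congr (_ * _).
by rewrite invfM -mulrA mulVf ?mulr1// gt_eqF// pi_gt0.
Qed.

End transfer.

(* eta_i = d rho_ss / d sigma_i^2 exists and equals
   1/2 [Delta^2 L^+ cos(tau L) (M_n - sin(tau L))^+]_{ii}. *)
Theorem theorem7 (R : realType) (n : nat) (a : 'M[R]_n) (tau : R)
    (q : 'I_n -> R) :
  weighted_graph a -> graph_connected a ->
  0 <= tau -> tau * lambda_max (laplacian a) < pi / 2 ->
  (forall k, 0 < q k) ->
  forall i : 'I_n,
    is_derive (q i) 1 (fun t : R => rho_int tau a (upd q i t))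
      (2^-1 * (degmx a ^+ 2 *m mp_pinv (laplacian a) *m matcos (tau *: laplacian a)
               *m mp_pinv (@Mn R n - matsin (tau *: laplacian a))) i i).
Proof.
move=> wg gc tau0 tl q0 i.
have [P [d [Pu LE]]] := symmetric_diagonalizable (laplacian_sym wg).
have -> : (degmx a ^+ 2 *m mp_pinv (laplacian a) *m matcos (tau *: laplacian a)
      *m mp_pinv (@Mn R n - matsin (tau *: laplacian a))) i i =
    degmx a i i ^+ 2 * fc P (mode_gain tau \o d) i i.
  have p1 : mp_pinv (laplacian a) = fc P (fun k => (d k)^-1).
    by rewrite LE; exact: (mp_pinv_spectral wg Pu LE id).
  have tLE : tau *: laplacian a = fc P (fun k => tau * d k) by rewrite LE fcZ.
  have p2 : mp_pinv (Mn R n - matsin (tau *: laplacian a)) =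
      fc P (fun k => (nz (d k) - sin (tau * d k))^-1).
    rewrite tLE matsin_fc// (Mn_spectral wg gc Pu LE) fcB.
    exact: (mp_pinv_spectral wg Pu LE (fun x => nz x - sin (tau * x))).
  rewrite p1 p2 tLE matcos_fc// -mulmxA -mulmxA !fcM//.
  have -> : fc P (mode_gain tau \o d) = fc P (fun k => (d k)^-1 *
      (cos (tau * d k) * (nz (d k) - sin (tau * d k))^-1)).
    by apply: eq_fc => k; rewrite /= /mode_gain mulrA.
  move: (fc P _) => X; rewrite expr2 -[degmx a * _]/(degmx a *m _) -mulmxA /degmx.
  by rewrite !mul_diag_mx !mxE eqxx mulr1n mulrA expr2.
pose K k := degmx a k k ^+ 2 * fc P (mode_gain tau \o d) k k.
have rhoE (s : 'I_n -> R) : (forall k, 0 <= s k) ->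
    rho_int tau a s = 2^-1 * \sum_k s k * K k.
  move=> s0; rewrite /rho_int (rho_ssE wg gc tau0 tl Pu LE); congr (_ * _).
  by apply: eq_bigr => k _; rewrite exprMn sqr_sqrtr// /K; ring.
pose c := 2^-1 * \sum_(k | k != i) q k * K k.
(* [Num.sqrt] squares back only on nonnegative arguments, so the affine formula is used near
   [q i > 0]; [c] gathers the other intensities. *)
apply: (@near_eq_is_derive _ _ _ (fun t : R => c + 2^-1 * K i * t)).
  near=> t; rewrite rhoE; last first.
    move=> k; rewrite /upd; case: eqP => _; last exact: ltW.
    by apply/ltW; near: t; exact: lt_nbhsr.
  rewrite (bigD1 i)//= /upd eqxx mulrDr addrC /c; congr (_ + _); first by ring.
  by congr (_ * _); apply: eq_bigr => k /negbTE ->.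
have h := is_deriveD (is_derive_cst c (q i) 1) (is_derive_lin (2^-1 * K i) (q i)).
by apply: is_derive_eq h _; rewrite add0r.
Unshelve. all: by end_near. Qed.
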